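(* Let $k$ be an algebraically closed field of characteristic different from $2$ and $3$. Let $(E,V,\phi,\xi)$ be an algebraic quadruple such that $\xi$ defines a point of $\mathbb{P}(V^\vee)$ outside the discriminant locus of the net of conics $\phi$, and let $f\colon Y\to X$ be the degree $4$ morphism associated to $(E,V,\phi,\xi)$. Then $$(E,V,\phi,\xi)\cong(E_{Y/X},V_{Y/X},\phi_{Y/X},\xi_{Y/X}),$$ i.e. there are linear isomorphisms $E\cong E_{Y/X}$ and $V\cong V_{Y/X}$ identifying $\phi$ with $\phi_{Y/X}$ and $\xi$ with $\xi_{Y/X}$ (the latter up to a nonzero scalar).
   Context: For a vector space $W$, $\mathbb{P}(W)=\mathrm{Proj}\,\mathrm{Sym}(W^\vee)$ is the space of lines in $W$. An algebraic quadruple is a tuple $(E,V,\phi,\xi)$ where $E,V$ are $3$-dimensional $k$-vector spaces, $\phi\colon\mathrm{Sym}^2E\to V$ is a surjective linear map defining a basepoint-free net of conics, and $\xi\colon V\to k$ is a nonzero linear map (considered up to scalars). The net attached to $\phi$ is the family, parametrised by $\mathbb{P}(V^\vee)$, of conics $\{[e]\in\mathbb{P}(E)\mid\eta(\phi(e\cdot e))=0\}$ for $\eta\in V^\vee\setminus\{0\}$; it is basepoint-free if $\phi(e\cdot e)\ne0$ for all $e\ne0$. Its discriminant locus is the set of $[\eta]\in\mathbb{P}(V^\vee)$ whose conic is singular. The morphism associated to a quadruple: let $Z=\mathbb{P}(E)$, $T=\mathbb{P}(V)$ and $g\colon Z\to T$, $[e]\mapsto[\phi(e\cdot e)]$, a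 finite morphism of degree $4$. Let $X=\mathbb{P}(\ker\xi)\subset T$ be the line defined by $\xi$ and let $f\colon Y=X\times_TZ\to X$ be the base change of $g$. Then $Y$ is the conic of the net corresponding to $\xi$; if $\xi$ lies outside the discriminant locus, $Y$ is a smooth conic and $f$ is a finite degree $4$ morphism with $X\cong Y\cong\mathbb{P}^1$. The quadruple attached to a finite degree $4$ morphism $f\colon Y\to X$ with $X,Y\cong\mathbb{P}^1$: let $\omega_{Y/X}$ be the line bundle on $Y$ with $f_*\omega_{Y/X}=\mathcal{H}om(f_*\mathcal{O}_Y,\mathcal{O}_X)$ as $f_*\mathcal{O}_Y$-modules. Dualising the multiplication of $f_*\mathcal{O}_Y$ and twisting gives a copairing $\delta\colon f_*\omega_{Y/X}^{-1}\to f_*\mathcal{O}_Y\otimes_{\mathcal{O}_X}f_*\mathcal{O}_Y$; locally, if $\lambda$ is a local generator of $\omega_{Y/X}$ with dual generator $\lambda^{-1}$ of $\omega_{Y/X}^{-1}$, and $(e_i),(f_i)$ are local $\mathcal{O}_X$-bases of $f_*\mathcal{O}_Y$ with $\lambda(e_if_j)=\delta_{ij}$, then $\delta(b\lambda^{-1})=\sum_ibe_i\otimes f_i$. Put $\mathcal{F}_{Y/X}=f_*\mathcal{O}_Y/\mathcal{O}_X$ and $\mathcal{Q}_{Y/X}=\mathrm{coker}(f_*\omega_{Y/X}^{-1}\to\mathrm{Sym}^2\mathcal{F}_{Y/X})$, where the map is $\delta$ followed by the projection. One has $\mathcal{F}_{Y/X}(1)\cong\mathcal{O}_X^{\oplus3}$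 and $\mathcal{Q}_{Y/X}(2)\cong\mathcal{O}_X\oplus\mathcal{O}_X(1)$. Define $E_{Y/X}=H^0(X,\mathcal{F}_{Y/X}(1))$, $V_{Y/X}=H^0(X,\mathcal{Q}_{Y/X}(2))$, $\phi_{Y/X}\colon\mathrm{Sym}^2E_{Y/X}\to V_{Y/X}$ the map induced on global sections by the quotient map $\mathrm{Sym}^2\mathcal{F}_{Y/X}\to\mathcal{Q}_{Y/X}$ (twisted by $\mathcal{O}_X(2)$), and $\xi_{Y/X}\colon V_{Y/X}\to k$ the map (defined up to scalar) obtained by taking global sections of the unique (up to scalar) nonzero morphism $\mathcal{Q}_{Y/X}(2)\cong\mathcal{O}_X\oplus\mathcal{O}_X(1)\to\mathcal{O}_X$. *)

(* Defs.v *)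
From HB Require Import structures.
From mathcomp Require Import all_boot all_order all_algebra.
From mathcomp Require Import finmap boolp classical_sets functions cardinality.

Set Implicit Arguments.
Unset Strict Implicit.
Unset Printing Implicit Defensive.

Import GRing.Theory.
Local Open Scope classical_set_scope.
Local Open Scope ring_scope.
Local Open Scope quotient_scope.

(** * Modules: quotients, restriction of scalars, symmetric squares *)

Section SubmoduleSpan.
Context (R : pzRingType) (M : lmodType R) (G : set M).

Definition is_submodule (N : set M) : Prop :=
  N 0 /\ forall (a : R) (x y : M), N x -> N y -> N (a *: x + y).

Definition submod_span : set M :=
  [set x | forall N : set M, is_submodule N -> G `<=` N -> N x].

Definition in_span : {pred M} := fun x => `[< submod_span x >].

Lemma in_span_submod : submod_closed in_span.
Proof.
split; first by apply/asboolP => N [].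
move=> a x y /asboolP xS /asboolP yS; apply/asboolP => N NS GN.
by apply: NS.2; [exact: xS | exact: yS].
Qed.

HB.instance Definition _ := GRing.isSubmodClosed.Build R M in_span in_span_submod.

Lemma in_span_gen x : G x -> x \in in_span.
Proof. by move=> Gx; apply/asboolP => N _; apply. Qed.

(** [quotmod G] is the quotient of [M] by the submodule generated by [G]. *)
Definition quotmod : Type := Quotient.quot in_span.

HB.instance Definition _ := Choice.on quotmod.
HB.instance Definition _ := GRing.Zmodule.on quotmod.

Definition quot_pr (x : M) : quotmod := \pi_(Quotient.quot in_span) x.

Lemma quot_pr_eq x y : (quot_pr x == quot_pr y) = (x - y \in in_span).
Proof. by rewrite Quotient.idealrBE. Qed.

Lemma quot_prD x y : quot_pr (x + y) = quot_pr x + quot_pr y.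
Proof. exact: (raddfD (\pi_(Quotient.quot in_span))). Qed.

Lemma quot_pr_surj (q : quotmod) : exists x, q = quot_pr x.
Proof. by exists (repr (q : Quotient.quot in_span)); rewrite /quot_pr reprK. Qed.

Definition quot_scale (a : R) (q : quotmod) : quotmod :=
  quot_pr (a *: repr (q : Quotient.quot in_span)).

Lemma quot_scaleE a x : quot_scale a (quot_pr x) = quot_pr (a *: x).
Proof.
apply/eqP; rewrite quot_pr_eq -scalerBr rpredZ // -quot_pr_eq.
by rewrite /quot_pr reprK.
Qed.

Lemma quot_scaleA a b v : quot_scale a (quot_scale b v) = quot_scale (a * b) v.
Proof. by case: (quot_pr_surj v) => x ->; rewrite !quot_scaleE scalerA. Qed.
Lemma quot_scale1 : left_id 1 quot_scale.
Proof. by move=> v; case: (quot_pr_surj v) => x ->; rewrite quot_scaleE scale1r. Qed.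
Lemma quot_scaleDr : right_distributive quot_scale +%R.
Proof.
move=> a v w; case: (quot_pr_surj v) => x ->; case: (quot_pr_surj w) => y ->.
by rewrite -quot_prD !quot_scaleE scalerDr quot_prD.
Qed.
Lemma quot_scaleDl v : {morph quot_scale^~ v : a b / a + b}.
Proof.
move=> a b; case: (quot_pr_surj v) => x ->.
by rewrite !quot_scaleE scalerDl quot_prD.
Qed.

HB.instance Definition _ := GRing.Zmodule_isLmodule.Build R quotmod
  quot_scaleA quot_scale1 quot_scaleDr quot_scaleDl.

Lemma quot_pr_linear : linear quot_pr.
Proof. by move=> a x y; rewrite quot_prD -quot_scaleE. Qed.

HB.instance Definition _ := GRing.isLinear.Build R M quotmod *:%R quot_pr quot_pr_linear.

Lemma quot_pr_gen x : G x -> quot_pr x = 0.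
Proof.
move=> Gx; apply/eqP; rewrite -(linear0 quot_pr) quot_pr_eq subr0.
exact: in_span_gen.
Qed.

Section Lift.
Context (N : lmodType R) (g : {linear M -> N}) (gG : forall x, G x -> g x = 0).

Definition quot_lift_fun (q : quotmod) : N := g (repr (q : Quotient.quot in_span)).

Lemma quot_lift_funE x : quot_lift_fun (quot_pr x) = g x.
Proof.
apply/eqP; rewrite -subr_eq0 -linearB.
have : repr (quot_pr x : Quotient.quot in_span) - x \in in_span.
  by rewrite -quot_pr_eq /quot_pr reprK.
move=> /asboolP/(_ [set y | g y = 0]) /= -> //; split; first exact: linear0.
by move=> a y z /= gy gz; rewrite linearP gy gz scaler0 addr0.
Qed.

Lemma quot_lift_linear : linear quot_lift_fun.
Proof.
move=> a v w; case: (quot_pr_surj v) => x ->; case: (quot_pr_surj w) => y ->.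
by rewrite -linearP !quot_lift_funE linearP.
Qed.

Definition quot_lift : {linear quotmod -> N} :=
  HB.pack quot_lift_fun (GRing.isLinear.Build R quotmod N *:%R quot_lift_fun quot_lift_linear).

Lemma quot_liftE x : quot_lift (quot_pr x) = g x.
Proof. exact: quot_lift_funE. Qed.
End Lift.
End SubmoduleSpan.

(** [restr rho M] is the [S]-module [M] seen as an [R]-module through [rho]. *)
Definition restr (R S : pzRingType) (rho : {rmorphism R -> S}) (M : lmodType S) : Type := M.

Section Restriction.
Context (R S : pzRingType) (rho : {rmorphism R -> S}) (M : lmodType S).
Local Notation restr := (restr rho M).

HB.instance Definition _ := GRing.Zmodule.copy restr M.

Definition restr_scale (a : R) (x : restr) : restr := rho a *: (x : M).

Fact restr_scaleA a b v : restr_scale a (restr_scale b v) = restr_scale (a * b) v.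
Proof. by rewrite /restr_scale scalerA rmorphM. Qed.
Fact restr_scale1 : left_id 1 restr_scale.
Proof. by move=> v; rewrite /restr_scale rmorph1 scale1r. Qed.
Fact restr_scaleDr : right_distributive restr_scale +%R.
Proof. by move=> a v w; rewrite /restr_scale scalerDr. Qed.
Fact restr_scaleDl v : {morph restr_scale^~ v : a b / a + b}.
Proof. by move=> a b; rewrite /restr_scale rmorphD scalerDl. Qed.

HB.instance Definition _ := GRing.Zmodule_isLmodule.Build R restr
  restr_scaleA restr_scale1 restr_scaleDr restr_scaleDl.

Lemma restrE a (x : restr) : a *: x = (rho a *: (x : M) : M).
Proof. by []. Qed.
End Restriction.

Section FreeModule.
Context (R : pzRingType) (T : choiceType).

Definition fin_supp : {pred T -> R^o} := fun f => `[< finite_set [set x | f x != 0] >].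

Lemma fin_supp_submod : submod_closed fin_supp.
Proof.
split.
  apply/asboolP; apply: sub_finite_set (finite_set0 T) => x /=.
  by rewrite eqxx.
move=> a f g /asboolP ff /asboolP fg; apply/asboolP.
have/sub_finite_set : [set x | (a *: f + g) x != 0] `<=`
    [set x | f x != 0] `|` [set x | g x != 0].
  move=> x /=; rewrite -[(a *: f + g) x]/(a * f x + g x).
  have [->|] := eqVneq (f x) 0; last by left.
  by rewrite mulr0 add0r; right.
by apply; rewrite finite_setU.
Qed.

HB.instance Definition _ := GRing.isSubmodClosed.Build R (T -> R^o) fin_supp fin_supp_submod.

(** Free [R]-module on [T]: finitely supported functions [T -> R]. *)
Record freemod : Type := Freemod { freemod_val :> T -> R^o; _ : freemod_val \in fin_supp }.

HB.instance Definition _ := [isSub for freemod_val].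
HB.instance Definition _ := [Choice of freemod by <:].
HB.instance Definition _ := [SubChoice_isSubLmodule of freemod by <:].

Lemma free_gen_subproof (x : T) : (fun y => (y == x)%:R : R^o) \in fin_supp.
Proof.
apply/asboolP; apply: sub_finite_set (finite_set1 x) => y /=.
by have [->|_] := eqVneq y x => //; rewrite eqxx.
Qed.
Definition free_gen (x : T) : freemod := Freemod (free_gen_subproof x).

Context (N : lmodType R) (b : T -> N).

Definition free_lift (f : freemod) : N :=
  \sum_(x <- fset_set [set x | f x != 0]) (f x : R) *: b x.

Lemma free_liftE (f : freemod) (X : seq T) : uniq X ->
  (forall x, f x != 0 -> x \in X) -> free_lift f = \sum_(x <- X) (f x : R) *: b x.
Proof.
move=> uX fX; rewrite /free_lift.
rewrite [RHS](bigID (fun x => f x != 0)) /= [X in _ + X]big1 ?addr0; last first.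
  by move=> x; rewrite negbK => /eqP ->; rewrite scale0r.
rewrite -[RHS]big_filter; apply: perm_big; apply: uniq_perm.
- exact: fset_uniq.
- exact: filter_uniq.
move=> x; rewrite mem_filter in_fset_set; last by case: (f) => g /= /asboolP.
apply/idP/andP => [|[fx _]]; last by rewrite inE.
by rewrite inE /= => fx; split; [exact: fx | exact: fX].
Qed.

Lemma free_lift_gen x : free_lift (free_gen x) = b x.
Proof.
rewrite (@free_liftE _ [:: x]) // => [|y /=].
  by rewrite big_seq1 /= eqxx scale1r.
by rewrite inE; have [//|_] := eqVneq y x; rewrite eqxx.
Qed.

Lemma free_lift_linear : linear free_lift.
Proof.
move=> a f g.
pose S (h : freemod) : seq T := fset_set [set x | h x != 0].
have SP (h : freemod) x : h x != 0 -> x \in S h.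
  by move=> hx; rewrite /S in_fset_set ?inE //; case: (h) => u /= /asboolP.
pose X := undup (S f ++ S g ++ S (a *: f + g)).
have XP (h : freemod) : h \in [:: f; g; a *: f + g] -> forall x, h x != 0 -> x \in X.
  move=> hh x /SP; rewrite mem_undup !mem_cat.
  by move: hh; rewrite !inE => /or3P[] /eqP-> ->; rewrite ?orbT.
rewrite !(@free_liftE _ X) ?undup_uniq //; do ?by apply: XP; rewrite !inE eqxx ?orbT.
rewrite scaler_sumr -big_split /=; apply: eq_bigr => x _.
by rewrite scalerA -scalerDl.
Qed.

HB.instance Definition _ := GRing.isLinear.Build R freemod N *:%R free_lift free_lift_linear.

End FreeModule.

(** The symmetric square: the free module on [M * M] modulo bilinearity and
    symmetry; [sprod x y] is the class of [x . y]. *)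
Section SymSquare.
Context (R : pzRingType) (M : lmodType R).

Definition sym2_rel : set (freemod R (M * M)%type) :=
  [set f | exists (a : R) (x y z : M),
     f = free_gen R (a *: x + y, z) - (a *: free_gen R (x, z) + free_gen R (y, z))] `|`
  [set f | exists x y : M, f = free_gen R (x, y) - free_gen R (y, x)].

Definition Sym2 : Type := quotmod sym2_rel.
HB.instance Definition _ := GRing.Lmodule.on Sym2.

Definition sprod (x y : M) : Sym2 := quot_pr sym2_rel (free_gen R (x, y)).

Lemma sprodC x y : sprod x y = sprod y x.
Proof.
apply/eqP; rewrite quot_pr_eq; apply: in_span_gen.
by right; exists x, y.
Qed.

Lemma sprodPl a x y z : sprod (a *: x + y) z = a *: sprod x z + sprod y z.
Proof.
rewrite /sprod -linearP; apply/eqP; rewrite quot_pr_eq; apply: in_span_gen.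
by left; exists a, x, y, z.
Qed.

Lemma sprodPr a x y z : sprod z (a *: x + y) = a *: sprod z x + sprod z y.
Proof. by rewrite sprodC sprodPl !(sprodC _ z). Qed.

Lemma sprodZl a x z : sprod (a *: x) z = a *: sprod x z.
Proof.
have s0 : sprod 0 z = 0.
  apply: (@addrI _ (sprod 0 z)); rewrite addr0 -[X in X + _]scale1r -sprodPl.
  by rewrite scaler0 addr0.
by rewrite -[a *: x]addr0 sprodPl s0 addr0.
Qed.

Definition sym_bilinear (N : lmodType R) (b : M -> M -> N) : Prop :=
  (forall x y, b x y = b y x) /\
  (forall a x y z, b (a *: x + y) z = a *: b x z + b y z).

Section Lift.
Context (N : lmodType R) (b : M -> M -> N) (hb : sym_bilinear b).

Lemma sym2_lift_subproof f : sym2_rel f -> free_lift (fun p => b p.1 p.2) f = 0.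
Proof.
case: hb => bC bP.
case=> [[a [x [y [z ->]]]]|[x [y ->]]].
  by rewrite linearB /= linearP /= !free_lift_gen /= bP subrr.
by rewrite linearB /= !free_lift_gen /= bC subrr.
Qed.

Definition sym2_lift : {linear Sym2 -> N} := quot_lift sym2_lift_subproof.

Lemma sym2_liftE x y : sym2_lift (sprod x y) = b x y.
Proof.
rewrite quot_liftE.
exact: (free_lift_gen (fun p : M * M => b p.1 p.2) (x, y)).
Qed.
End Lift.
End SymSquare.

(** * Regular functions on cones *)

(** [form d p]: [p] is a homogeneous polynomial function of degree [d] on [E]. *)
Inductive form (k : fieldType) (E : lmodType k) : nat -> (E -> k) -> Prop :=
| form_const c : form 0 (fun=> c)
| form_scalar (l : {scalar E}) : form 1 l
| form_add d p q : form d p -> form d q -> form d (fun x => p x + q x)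
| form_mul d1 d2 p q : form d1 p -> form d2 q -> form (d1 + d2) (fun x => p x * q x).

Section Regular.
Context (k : fieldType) (E : lmodType k) (D : set E).

(** For [D] a locally closed cone of [E] without [0], [reg D] is the ring of
    regular functions on the quasi-projective variety of lines in [D]: functions
    that are locally quotients of two forms of the same degree. *)
Definition is_regular (g : D -> k) : Prop :=
  forall p : D, exists d (P Q : E -> k),
    [/\ form d P, form d Q, Q (val p) != 0 &
        forall v : D, Q (val v) != 0 -> g v = P (val v) / Q (val v)].

Definition regular : {pred D -> k} := fun g => `[< is_regular g >].

Lemma regular_subring : subring_closed regular.
Proof.
split.
- apply/asboolP => p; exists 0, (fun=> 1), (fun=> 1).
  by split; [exact: form_const | exact: form_const | exact: oner_neq0 |
             move=> v _; rewrite divr1].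
- move=> f g /asboolP rf /asboolP rg; apply/asboolP => p.
  have [d1 [P1 [Q1 [fP1 fQ1 Q1p e1]]]] := rf p.
  have [d2 [P2 [Q2 [fP2 fQ2 Q2p e2]]]] := rg p.
  exists (d1 + d2), (fun x => P1 x * Q2 x + (-1) * (Q1 x * P2 x)),
    (fun x => Q1 x * Q2 x); split.
  + apply: form_add; first exact: form_mul.
    by apply: (@form_mul _ _ 0); [exact: form_const | exact: form_mul].
  + exact: form_mul.
  + by rewrite mulf_neq0.
  + move=> v; rewrite mulf_eq0 negb_or => /andP[Q1v Q2v].
    rewrite -[LHS]/(f v - g v) e1 // e2 // mulN1r.
    by rewrite -mulNr addf_div // mulNr [P2 _ * _]mulrC.
- move=> f g /asboolP rf /asboolP rg; apply/asboolP => p.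
  have [d1 [P1 [Q1 [fP1 fQ1 Q1p e1]]]] := rf p.
  have [d2 [P2 [Q2 [fP2 fQ2 Q2p e2]]]] := rg p.
  exists (d1 + d2), (fun x => P1 x * P2 x), (fun x => Q1 x * Q2 x); split.
  + exact: form_mul.
  + exact: form_mul.
  + by rewrite mulf_neq0.
  + move=> v; rewrite mulf_eq0 negb_or => /andP[Q1v Q2v].
    by rewrite -[LHS]/(f v * g v) e1 // e2 // mulf_div.
Qed.

HB.instance Definition _ := GRing.isSubringClosed.Build (D -> k) regular regular_subring.

Record reg : Type := Reg { reg_fun :> D -> k; _ : reg_fun \in regular }.

HB.instance Definition _ := [isSub for reg_fun].
HB.instance Definition _ := [Choice of reg by <:].
HB.instance Definition _ := GRing.SubChoice_isSubComPzRing.Build _ _ reg regular_subring.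

Lemma regP (g : reg) : is_regular g.
Proof. by case: g => g /= /asboolP. Qed.

Lemma reg_eq (f g : reg) : (forall v, f v = g v) -> f = g.
Proof. by move=> fg; apply: val_inj; apply/funext. Qed.

Lemma reg_const_subproof (c : k) : (fun=> c) \in regular.
Proof.
apply/asboolP => p; exists 0, (fun=> c), (fun=> 1).
by split; [exact: form_const | exact: form_const | exact: oner_neq0 |
           move=> v _; rewrite divr1].
Qed.
Definition reg_const (c : k) : reg := Reg (reg_const_subproof c).

Lemma reg_const_zmod : zmod_morphism reg_const.
Proof. by move=> a b; apply: val_inj; apply/funext. Qed.
Lemma reg_const_monoid : monoid_morphism reg_const.
Proof. by split=> [|a b]; apply: val_inj; apply/funext. Qed.
HB.instance Definition _ := GRing.isZmodMorphism.Build k reg reg_const reg_const_zmod.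
HB.instance Definition _ := GRing.isMonoidMorphism.Build k reg reg_const reg_const_monoid.
End Regular.

Section Pullback.
Context (k : fieldType) (E E' : lmodType k) (D : set E) (D' : set E') (h : E' -> E).

Definition homog_map : Prop :=
  exists m, forall l : {scalar E}, form m (fun x => l (h x)).

Lemma form_comp m d p : (forall l : {scalar E}, form m (fun x => l (h x))) ->
  form d p -> form (d * m) (fun x => p (h x)).
Proof.
move=> hm; elim=> {d p} [c|l|d p q _ ip _ iq|d1 d2 p q _ ip _ iq].
- exact: form_const.
- by rewrite mul1n; exact: hm.
- exact: form_add.
- by rewrite mulnDl; exact: form_mul.
Qed.

Hypotheses (hh : homog_map) (hD : forall v, D' v -> D (h v)).

Definition pull_point (v : D') : D :=
  exist _ (h (val v)) (mem_set (hD (set_mem (valP v)))).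

Lemma pull_regular (g : reg D) : (fun v => g (pull_point v)) \in @regular _ _ D'.
Proof.
case: hh => m hm; apply/asboolP => p.
have [d [P [Q [fP fQ Qp e]]]] := regP g (pull_point p).
exists (d * m)%N, (fun x => P (h x)), (fun x => Q (h x)).
split; [exact: form_comp | exact: form_comp | exact: Qp |].
by move=> v Qv; rewrite e.
Qed.

Definition pullback_fun (g : reg D) : reg D' := Reg (pull_regular g).

Lemma pullback_zmod : zmod_morphism pullback_fun.
Proof. by move=> a b; apply: val_inj; apply/funext. Qed.
Lemma pullback_monoid : monoid_morphism pullback_fun.
Proof. by split=> [|a b]; apply: val_inj; apply/funext. Qed.

Definition pullback : {rmorphism reg D -> reg D'} :=
  HB.pack pullback_fun
    (GRing.isZmodMorphism.Build (reg D) (reg D') pullback_fun pullback_zmod)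
    (GRing.isMonoidMorphism.Build (reg D) (reg D') pullback_fun pullback_monoid).
End Pullback.

Lemma homog_id (k : fieldType) (E : lmodType k) : homog_map (@id E).
Proof. by exists 1 => l; exact: form_scalar. Qed.

(** Restriction of regular functions to a smaller open set. *)
Definition reg_res (k : fieldType) (E : lmodType k) (D D' : set E) (sub : D' `<=` D) :
  {rmorphism reg D -> reg D'} := pullback (@homog_id k E) sub.

(** * The sheaves attached to a finite morphism, on one chart *)

Section Chart.
(** [rho : O_X(U) -> O_Y(f^-1 U)] for an affine open set [U] of [X]. *)
Context (R A : comPzRingType) (rho : {rmorphism R -> A}).

(** [f_* O_Y] as an [O_X]-module, and its quotient by the image of [O_X]. *)
Definition dirim : lmodType R := restr rho (A^o : lmodType A).

Definition FF : lmodType R := quotmod (M := dirim) [set (1 : A)].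

Definition FFpr (a : A) : FF := quot_pr _ (a : dirim).

(** [lam] is a generator of [Hom_R(A, R)], i.e. of [omega_{Y/X}], as an [A]-module,
    where [b] acts on [lam] by [(b lam)(a) = lam (b a)]. *)
Definition is_generator (lam : {linear dirim -> R^o}) : Prop :=
  forall psi : {linear dirim -> R^o},
    exists! b : A, forall a : A, psi a = lam (b * a : A).

Definition is_basis n (e : 'I_n -> A) : Prop :=
  forall a : A, exists! c : 'I_n -> R, a = \sum_i rho (c i) * e i.

(** The image of the map [f_* omega^-1 -> Sym2 F] which sends [b lam^-1] to the class
    of [\sum_i b e_i (x) f_i], for [lam] a generator of [omega] and [e], [f] bases
    of [f_* O_Y] dual for [lam]. The copairing does not depend on these choices,
    so they may range over all the possible ones. On a nonempty affine open set of
    a projective line all line bundles and vector bundles are trivial, likewise on its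
    inverse image in [Y] when [Y] is a projective line, so that no further
    localisation is needed for [lam], [e] and [f] to exist. *)
Definition copairing_image : set (Sym2 FF) :=
  [set s | exists n (lam : {linear dirim -> R^o}) (e f : 'I_n -> A) (b : A),
     [/\ is_generator lam, is_basis e, is_basis f,
         forall i j, lam (e i * f j : A) = (i == j)%:R &
         s = \sum_i sprod (FFpr (b * e i)) (FFpr (f i))]].

(** [Q = coker (f_* omega^-1 -> Sym2 F)]. *)
Definition QQ : lmodType R := quotmod copairing_image.

Definition QQpr (s : Sym2 FF) : QQ := quot_pr _ s.

Lemma QQprP a s t : QQpr (a *: s + t) = a *: QQpr s + QQpr t.
Proof. exact: (linearP (quot_pr copairing_image)). Qed.
Lemma QQprZ a s : QQpr (a *: s) = a *: QQpr s.
Proof. exact: (linearZ_LR (quot_pr copairing_image)). Qed.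
Lemma QQpr0 : QQpr 0 = 0.
Proof. exact: (linear0 (quot_pr copairing_image)). Qed.
End Chart.

Section ChartRestriction.
Context (R A R' A' : comPzRingType).
Context (rho : {rmorphism R -> A}) (rho' : {rmorphism R' -> A'}).
Context (r : {rmorphism R -> R'}) (s : {rmorphism A -> A'}).
Hypothesis rs : forall a, s (rho a) = rho' (r a).

Definition FFres_fun (a : dirim rho) : restr r (FF rho') := FFpr rho' (s a).

Lemma FFres_linear : linear FFres_fun.
Proof.
move=> c a b; rewrite /FFres_fun.
rewrite -[c *: a + b]/(rho c * (a : A) + b : A) rmorphD rmorphM rs.
exact: (linearP (quot_pr (M := dirim rho') [set (1 : A')]) (r c)).
Qed.
HB.instance Definition _ := GRing.isLinear.Build R _ _ *:%R FFres_fun FFres_linear.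

Lemma FFres_gen (a : dirim rho) : [set (1 : A) : dirim rho] a -> FFres_fun a = 0.
Proof. by move=> ->; rewrite /FFres_fun rmorph1; exact: quot_pr_gen. Qed.

Definition FFres : {linear FF rho -> restr r (FF rho')} :=
  @quot_lift R (dirim rho) [set (1 : A)] _ FFres_fun FFres_gen.

Lemma FFresE a : FFres (FFpr rho a) = FFpr rho' (s a).
Proof. exact: quot_liftE. Qed.

Definition S2res_fun (x y : FF rho) : restr r (Sym2 (FF rho')) :=
  sprod (FFres x : FF rho') (FFres y : FF rho').

Lemma S2res_bilinear : sym_bilinear S2res_fun.
Proof.
split=> [x y|a x y z]; first exact: sprodC.
by rewrite /S2res_fun linearP; exact: sprodPl.
Qed.

Definition S2res : {linear Sym2 (FF rho) -> restr r (Sym2 (FF rho'))} :=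
  sym2_lift S2res_bilinear.

Lemma S2resE x y : S2res (sprod x y) = sprod (FFres x : FF rho') (FFres y : FF rho').
Proof. exact: sym2_liftE. Qed.
End ChartRestriction.

(** * Global sections over the projective line *)

(** A finite [X]-scheme [f : Y -> X], for [X] a projective line over [k], given
    by [f_* O_Y] on the standard charts [U0 = (x0 != 0)], [U1 = (x1 != 0)] and
    [U01 = U0 `&` U1]; [tX] is the function [x1 / x0] on [U01]. *)
Record P1_cover (k : fieldType) := P1Cover {
  OX0 : comPzRingType; OX1 : comPzRingType; OX01 : comPzRingType;
  OY0 : comPzRingType; OY1 : comPzRingType; OY01 : comPzRingType;
  f0 : {rmorphism OX0 -> OY0};
  f1 : {rmorphism OX1 -> OY1};
  f01 : {rmorphism OX01 -> OY01};
  rX0 : {rmorphism OX0 -> OX01};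
  rX1 : {rmorphism OX1 -> OX01};
  rY0 : {rmorphism OY0 -> OY01};
  rY1 : {rmorphism OY1 -> OY01};
  fr0 : forall a, rY0 (f0 a) = f01 (rX0 a);
  fr1 : forall a, rY1 (f1 a) = f01 (rX1 a);
  cst0 : {rmorphism k -> OX0};
  cst1 : {rmorphism k -> OX1};
  cst01 : forall c, rX0 (cst0 c) = rX1 (cst1 c);
  tX : OX01 }.

Section GlobalSections.
Context (k : fieldType) (f : P1_cover k).

Definition FF0 : lmodType k := restr (cst0 f) (FF (f0 f)).
Definition FF1 : lmodType k := restr (cst1 f) (FF (f1 f)).
Definition QQ0 : lmodType k := restr (cst0 f) (QQ (f0 f)).
Definition QQ1 : lmodType k := restr (cst1 f) (QQ (f1 f)).

Definition resF0 (x : FF (f0 f)) : FF (f01 f) := FFres (@fr0 _ f) x.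
Definition resF1 (x : FF (f1 f)) : FF (f01 f) := FFres (@fr1 _ f) x.
Definition resS0 (s : Sym2 (FF (f0 f))) : Sym2 (FF (f01 f)) := S2res (@fr0 _ f) s.
Definition resS1 (s : Sym2 (FF (f1 f))) : Sym2 (FF (f01 f)) := S2res (@fr1 _ f) s.

Lemma resF0P c x y : resF0 (c *: x + y) = rX0 f c *: resF0 x + resF0 y.
Proof. exact: (linearP (FFres (@fr0 _ f)) c). Qed.
Lemma resF1P c x y : resF1 (c *: x + y) = rX1 f c *: resF1 x + resF1 y.
Proof. exact: (linearP (FFres (@fr1 _ f)) c). Qed.
Lemma resS0P c x y : resS0 (c *: x + y) = rX0 f c *: resS0 x + resS0 y.
Proof. exact: (linearP (S2res (@fr0 _ f)) c). Qed.
Lemma resS1P c x y : resS1 (c *: x + y) = rX1 f c *: resS1 x + resS1 y.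
Proof. exact: (linearP (S2res (@fr1 _ f)) c). Qed.

(** A section of [M(n)] is a pair [(m0, m1)] such that [m0 * x0 ^ n = m1 * x1 ^ n]
    on [U01], i.e. [m0 = tX ^ n * m1]. *)
Definition F1_section : {pred (FF0 * FF1)%type} := fun x =>
  `[< resF0 x.1 = tX f *: resF1 x.2 >].

(** Agreement on [U01] of sections of [Q(2)] is expressed on representatives in
    [Sym2 F], which exist since each chart is affine. *)
Definition Q2_section : {pred (QQ0 * QQ1)%type} := fun q =>
  `[< exists (s0 : Sym2 (FF (f0 f))) (s1 : Sym2 (FF (f1 f))),
        [/\ q.1 = QQpr s0, q.2 = QQpr s1 &
            QQpr (resS0 s0) = tX f ^+ 2 *: QQpr (resS1 s1)] >].

Lemma resF00 : resF0 0 = 0. Proof. exact: (linear0 (FFres (@fr0 _ f))). Qed.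
Lemma resF10 : resF1 0 = 0. Proof. exact: (linear0 (FFres (@fr1 _ f))). Qed.
Lemma resS00 : resS0 0 = 0. Proof. exact: (linear0 (S2res (@fr0 _ f))). Qed.
Lemma resS10 : resS1 0 = 0. Proof. exact: (linear0 (S2res (@fr1 _ f))). Qed.

Lemma F1_section_submod : submod_closed F1_section.
Proof.
split; first by apply/asboolP; rewrite resF00 resF10 scaler0.
move=> c x y /asboolP xS /asboolP yS; apply/asboolP.
rewrite -[(c *: x + y).1]/(cst0 f c *: (x.1 : FF (f0 f)) + y.1).
rewrite -[(c *: x + y).2]/(cst1 f c *: (x.2 : FF (f1 f)) + y.2).
rewrite resF0P resF1P xS yS cst01 scalerDr !scalerA.
by rewrite [rX1 f _ * _]mulrC.
Qed.

Lemma Q2_section_submod : submod_closed Q2_section.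
Proof.
split.
  apply/asboolP; exists 0, 0; split; [exact/esym/QQpr0|exact/esym/QQpr0|].
  by rewrite resS00 resS10 !QQpr0 scaler0.
move=> c x y /asboolP[s0 [s1 [x1 x2 xS]]] /asboolP[t0 [t1 [y1 y2 yS]]].
apply/asboolP; exists (cst0 f c *: s0 + t0), (cst1 f c *: s1 + t1); split.
- rewrite -[(c *: x + y).1]/(cst0 f c *: (x.1 : QQ (f0 f)) + y.1).
  by rewrite x1 y1 QQprP.
- rewrite -[(c *: x + y).2]/(cst1 f c *: (x.2 : QQ (f1 f)) + y.2).
  by rewrite x2 y2 QQprP.
by rewrite resS0P resS1P !QQprP xS yS cst01 scalerDr !scalerA [rX1 f _ * _]mulrC.
Qed.

HB.instance Definition _ :=
  GRing.isSubmodClosed.Build k (FF0 * FF1 : lmodType k)%type F1_section F1_section_submod.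
HB.instance Definition _ :=
  GRing.isSubmodClosed.Build k (QQ0 * QQ1 : lmodType k)%type Q2_section Q2_section_submod.

(** [E_YX = H^0(X, F(1))] *)
Record E_YX : Type := EYX { EYX_val :> FF0 * FF1; _ : EYX_val \in F1_section }.
HB.instance Definition _ := [isSub for EYX_val].
HB.instance Definition _ := [Choice of E_YX by <:].
HB.instance Definition _ := [SubChoice_isSubLmodule of E_YX by <:].

(** [V_YX = H^0(X, Q(2))] *)
Record V_YX : Type := VYX { VYX_val :> QQ0 * QQ1; _ : VYX_val \in Q2_section }.
HB.instance Definition _ := [isSub for VYX_val].
HB.instance Definition _ := [Choice of V_YX by <:].
HB.instance Definition _ := [SubChoice_isSubLmodule of V_YX by <:].

Lemma resS0_sprod x y : resS0 (sprod x y) = sprod (resF0 x) (resF0 y).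
Proof. exact: S2resE. Qed.
Lemma resS1_sprod x y : resS1 (sprod x y) = sprod (resF1 x) (resF1 y).
Proof. exact: S2resE. Qed.

Lemma phi_YX_subproof (x y : E_YX) :
  ((QQpr (sprod (x.1 : FF (f0 f)) (y.1 : FF (f0 f))) : QQ0),
   (QQpr (sprod (x.2 : FF (f1 f)) (y.2 : FF (f1 f))) : QQ1)) \in Q2_section.
Proof.
case: x y => x /= /asboolP xS [y /= /asboolP yS].
apply/asboolP; exists (sprod (x.1 : FF (f0 f)) (y.1 : FF (f0 f))).
exists (sprod (x.2 : FF (f1 f)) (y.2 : FF (f1 f))); split=> //.
rewrite resS0_sprod resS1_sprod xS yS sprodZl sprodC sprodZl sprodC.
by rewrite scalerA -expr2 QQprZ.
Qed.

Definition phi_YX_fun (x y : E_YX) : V_YX := VYX (phi_YX_subproof x y).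

Lemma phi_YX_bilinear : sym_bilinear phi_YX_fun.
Proof.
split=> [x y|c x y z]; apply: val_inj => /=.
  by congr (QQpr _, QQpr _); exact: sprodC.
congr (_, _).
  rewrite -[LHS]/(QQpr (sprod (cst0 f c *: (x.1 : FF (f0 f)) + y.1) (z.1 : FF (f0 f)))).
  by rewrite sprodPl QQprP.
rewrite -[LHS]/(QQpr (sprod (cst1 f c *: (x.2 : FF (f1 f)) + y.2) (z.2 : FF (f1 f)))).
by rewrite sprodPl QQprP.
Qed.

Definition phi_YX : {linear Sym2 E_YX -> V_YX} := sym2_lift phi_YX_bilinear.

(** [xi] is a choice of [xi_{Y/X}], itself defined up to a scalar: [xi] is obtained on global sections from a nonzero morphism of sheaves
    [chi : Q(2) -> O_X], given by its components [chi0], [chi1] and [chi01] on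
    the three charts; over [U01], [Q(2)] is trivialised by [x0 ^ 2]. *)
Definition is_xi_YX (xi : {scalar V_YX}) : Prop :=
  exists (chi0 : {linear QQ (f0 f) -> (OX0 f)^o}) (chi1 : {linear QQ (f1 f) -> (OX1 f)^o})
         (chi01 : {linear QQ (f01 f) -> (OX01 f)^o}),
    [/\ forall s, chi01 (QQpr (resS0 s)) = rX0 f (chi0 (QQpr s)),
        forall s, chi01 (tX f ^+ 2 *: QQpr (resS1 s)) = rX1 f (chi1 (QQpr s)),
        (exists q, chi0 q != 0) \/ (exists q, chi1 q != 0) &
        forall v : V_YX, chi0 v.1 = cst0 f (xi v) /\ chi1 v.2 = cst1 f (xi v)].
End GlobalSections.

(** * Quadruples *)

Record quadruple (k : fieldType) := Quadruple {
  quadE : lmodType k;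
  quadV : lmodType k;
  quadphi : {linear Sym2 quadE -> quadV};
  quadxi : {scalar quadV} }.

Definition quadruple_iso (k : fieldType) (q q' : quadruple k) : Prop :=
  exists (alpha : {linear quadE q -> quadE q'}) (beta : {linear quadV q -> quadV q'}) (c : k),
    [/\ bijective alpha, bijective beta,
        forall x y, beta (quadphi q (sprod x y)) = quadphi q' (sprod (alpha x) (alpha y)),
        c != 0 &
        forall v, quadxi q' (beta v) = c * quadxi q v].

(** [aqphi_bpf] says that the net of conics has no base point; [aqxi] is to be
    understood up to nonzero scalars, which [quadruple_iso] accounts for. *)
Record algebraic_quadruple (k : fieldType) := AlgebraicQuadruple {
  aqE : vectType k;
  aqV : vectType k;
  aqphi : {linear Sym2 aqE -> aqV};
  aqxi : {scalar aqV};
  aqE_dim : \dim {: aqE} = 3;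
  aqV_dim : \dim {: aqV} = 3;
  aqphi_surj : forall v, exists s, aqphi s = v;
  aqphi_bpf : forall e, e != 0 -> aqphi (sprod e e) != 0;
  aqxi_neq0 : exists v, aqxi v != 0 }.

Section AttachedMorphism.
Context (k : fieldType) (q : algebraic_quadruple k).
Implicit Types (eta : {scalar aqV q}).

Definition quadruple_of : quadruple k := Quadruple (aqphi q) (aqxi q).

Definition conic eta : aqE q -> k := fun e => eta (aqphi q (sprod e e)).

(** Differential of [conic eta] at [e]. *)
Definition conic_diff eta (e : aqE q) : aqE q -> k :=
  fun e' => eta (aqphi q (sprod e e')) *+ 2.

Definition conic_singular eta : Prop :=
  exists e : aqE q, [/\ e != 0, conic eta e = 0 & forall e', conic_diff eta e e' = 0].

Definition discriminant_locus : set {scalar aqV q} :=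
  [set eta : {scalar aqV q} | (exists v, eta v != 0) /\ conic_singular eta].

(** The cone over [Y]. *)
Definition Ycone : set (aqE q) := [set e | conic (aqxi q) e = 0].

(** The cone over [X = P(ker xi)]. *)
Definition Xcone : set (aqV q) := [set v | aqxi q v = 0].

Definition gmap (e : aqE q) : aqV q := aqphi q (sprod e e).

Lemma gmap_homog : homog_map gmap.
Proof.
exists 2 => l.
pose B := vbasis {: aqE q}.
pose c i : {scalar aqE q} := coord B i.
pose d i (e : aqE q) : k := l (aqphi q (sprod e B`_i)).
have d_lin i : linear_for *%R (d i).
  by move=> a x y; rewrite /d sprodPl !linearP.
pose d' i : {scalar aqE q} :=
  HB.pack (d i) (GRing.isLinear.Build k (aqE q) k *%R (d i) (d_lin i)).
have eB e : e = \sum_i c i e *: B`_i by exact: coord_vbasis (memvf e).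
have -> : (fun e => l (gmap e)) = (fun e => \sum_i c i e * d' i e).
  apply/funext => e; rewrite /gmap.
  pose h x := l (aqphi q (sprod x e)).
  have h_lin : linear_for *%R h.
    by move=> a x y; rewrite /h sprodPl !linearP.
  pose h' : {scalar aqE q} :=
    HB.pack h (GRing.isLinear.Build k (aqE q) k *%R h h_lin).
  transitivity (h' (\sum_i c i e *: B`_i)); first by rewrite -eB.
  rewrite linear_sum; apply: eq_bigr => i _.
  by rewrite [LHS](linearZ_LR h') /= /h /d sprodC.
elim: (index_enum _) => [|i r IHr].
  have -> : (fun e => \sum_(i <- [::]) c i e * d' i e)
          = (fun e => (\0 : {scalar aqE q}) e * (\0 : {scalar aqE q}) e).
    by apply/funext => e; rewrite big_nil mulr0.
  by apply: (@form_mul _ _ 1 1); exact: form_scalar.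
have -> : (fun e => \sum_(j <- i :: r) c j e * d' j e)
        = (fun e => c i e * d' i e + \sum_(j <- r) c j e * d' j e).
  by apply/funext => e; rewrite big_cons.
by apply: form_add => //; apply: (@form_mul _ _ 1 1); exact: form_scalar.
Qed.

Context (x0 x1 : {scalar aqV q}).

(** Homogeneous coordinates on [X]. *)
Definition coordinates_on_X : Prop :=
  forall v, Xcone v -> x0 v = 0 -> x1 v = 0 -> v = 0.

Definition D0 : set (aqV q) := [set v | x0 v != 0].
Definition D1 : set (aqV q) := [set v | x1 v != 0].

Definition Xopen (U : set (aqV q)) : set (aqV q) := Xcone `&` U.
Definition Yopen (U : set (aqV q)) : set (aqE q) := Ycone `&` gmap @^-1` U.

Lemma gmap_open U v : Yopen U v -> Xopen U (gmap v).
Proof. by []. Qed.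

Lemma Xopen_sub U U' : U `<=` U' -> Xopen U `<=` Xopen U'.
Proof. by move=> sU v [vX vU]; split=> //; exact: sU. Qed.
Lemma Yopen_sub U U' : U `<=` U' -> Yopen U `<=` Yopen U'.
Proof. by move=> sU v [vX vU]; split=> //; exact: sU. Qed.

Definition fsharp U : {rmorphism reg (Xopen U) -> reg (Yopen U)} :=
  pullback gmap_homog (@gmap_open U).

Definition Xres U U' (sU : U `<=` U') : {rmorphism reg (Xopen U') -> reg (Xopen U)} :=
  reg_res (Xopen_sub sU).
Definition Yres U U' (sU : U `<=` U') : {rmorphism reg (Yopen U') -> reg (Yopen U)} :=
  reg_res (Yopen_sub sU).

Lemma fsharp_res U U' (sU : U `<=` U') a :
  Yres sU (fsharp U' a) = fsharp U (Xres sU a).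
Proof.
apply: reg_eq => v /=; congr (reg_fun a _); exact: val_inj.
Qed.

Lemma cst_res U U' U1 (sU : U `<=` U') (sU1 : U `<=` U1) (c : k) :
  Xres sU (@reg_const _ _ (Xopen U') c) = Xres sU1 (@reg_const _ _ (Xopen U1) c).
Proof. exact: reg_eq. Qed.

Lemma ratio_regular :
  (fun v : Xopen (D0 `&` D1) => x1 (val v) / x0 (val v)) \in @regular _ _ (Xopen (D0 `&` D1)).
Proof.
apply/asboolP => p; exists 1, x1, x0; split=> //; do ?exact: form_scalar.
by case: (set_mem (valP p)) => _ [].
Qed.

(** The morphism [f : Y -> X], [[e] |-> [phi (e . e)]], in the homogeneous coordinates
    [x0], [x1] of [X]. *)
Definition assoc_cover : P1_cover k :=
  {| f0 := fsharp D0; f1 := fsharp D1; f01 := fsharp (D0 `&` D1);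
     fr0 := fsharp_res (@subIsetl _ D0 D1);
     fr1 := fsharp_res (@subIsetr _ D0 D1);
     cst01 := @cst_res _ _ _ (@subIsetl _ D0 D1) (@subIsetr _ D0 D1);
     tX := Reg ratio_regular |}.

End AttachedMorphism.

(* Main.v *)
Require Import Defs.
From HB Require Import structures.
From mathcomp Require Import all_boot all_order all_algebra.
From mathcomp Require Import finmap boolp classical_sets functions cardinality.
From mathcomp Require Import ring.

Set Implicit Arguments.
Unset Strict Implicit.
Unset Printing Implicit Defensive.

Import GRing.Theory.
Local Open Scope ring_scope.

(** Write [B(e, e') = xi (phi (e e'))], [P_i(e) = x_i (phi (e e))], and let [x = x1 / x0]
    be the coordinate of [X].

    The smooth conic [Y] has equation [l0 l2 = l1^2] in a suitable basis of [E], so it is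
    parametrised by [s = l1 / l0], and the basis can be chosen with [P_0] vanishing at
    [s = oo] and [P_1] at [s = 0] ([frame_exists]). Let [p_i] be the polynomial [P_i]
    restricted to [Y]. Since [p1] has degree 4 and [p0] a smaller degree, over
    the chart [x0 != 0] the ring of [Y] is [R[s] / (F)], where [R = k[x]] and
    [F = p1 - x p0] has an invertible leading coefficient ([Ycoord_basis]). The other
    chart has the same shape in the coordinate [1 / s].

    For such a monogenic algebra Euler's functional [lam], the coefficient of [s^3] up to
    a unit, generates the relative canonical module ([euler_generator]). It vanishes on
    [1, s, s^2], the restrictions to [Y] of the linear forms of [E]. Thus the moments
    [lam (a l)], for [l] a linear form, only depend on [a] modulo [R] and define an
    isomorphism [F_{Y/X} -> E (x) R]. By Euler's residue formula the functionals of the two charts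
    match up to the factor [x s^2], so these isomorphisms glue to
    [F_{Y/X}(1) = E (x) O_X] ([th01_res0], [th01_res1]), and global sections give
    [E = E_{Y/X}].

    Under this identification the copairing becomes
    [b |-> (l l' |-> lam (b l l'))]. Hence a quadratic form kills its image as soon
    as it vanishes on the fibre of [Y] over [x], as do [B] and [P_1 - x P_0]; conversely these two forms
    cut out the image exactly ([netform_exact]). So [Q_{Y/X}(2)] is the quotient of [V (x) O_X]
    by the tautological line, and its sections are [V] ([VYX_coord]); by construction
    [phi_{Y/X}] becomes [phi]. Finally a morphism [Q_{Y/X}(2) -> O_X] has to kill the
    summand [O_X(1)], on which [xi] vanishes, so it is a multiple of [xi] ([xi_YX_unique]). *)

(** * Symmetric squares *)

Section SymSquareTheory.
Context (R : pzRingType) (M : lmodType R).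

Lemma freemod_sum (T : choiceType) (f : freemod R T) :
  f = free_lift (@free_gen R T) f.
Proof.
apply: val_inj => /=; apply/funext => x; rewrite /free_lift.
set X := fset_set _.
have xX : (x \in (X : seq T)) = (f x != 0).
  rewrite /X in_fset_set; last by case: (f) => g /= /asboolP.
  by apply/idP/idP; rewrite inE.
have -> r : (\sum_(y <- r) (f y : R) *: free_gen R y : freemod R T) x =
    \sum_(y <- r) f y * (x == y)%:R :> R.
  elim: r => [|y r IHr]; first by rewrite !big_nil.
  by rewrite !big_cons -IHr.
have [xf|/negPf xf] := boolP (x \in (X : seq T)); last first.
  rewrite big1_seq => [|y /andP[_ yX]]; first by apply/eqP; rewrite -[_ == _]negbK -xX xf.
  by case: eqP xf yX => [->|]; rewrite ?mulr0 // => -> .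
rewrite (big_rem x) //= eqxx mulr1 big1_seq ?addr0 // => y /andP[_].
rewrite mem_rem_uniq ?fset_uniq // inE => /andP[/negPf yx _].
by rewrite eq_sym yx mulr0.
Qed.

(** Identities between linear maps out of a symmetric square can thus be checked on
    products. *)
Lemma sym2_ind (P : set (Sym2 M)) : is_submodule P ->
  (forall x y, P (sprod x y)) -> forall t, P t.
Proof.
move=> [P0 PP] Pg t; case: (quot_pr_surj t) => f ->.
rewrite (freemod_sum f) /free_lift linear_sum /=.
elim/big_rec: _ => // -[x y] t' _ Pt'.
by rewrite linearZ /=; apply: PP => //; exact: Pg.
Qed.

Lemma sprodDl (x y z : M) : sprod (x + y) z = sprod x z + sprod y z.
Proof. by rewrite -[x]scale1r sprodPl !scale1r. Qed.

Lemma sprodZr (a : R) (x z : M) : sprod z (a *: x) = a *: sprod z x.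
Proof. by rewrite sprodC sprodZl sprodC. Qed.

Lemma sprod0l (z : M) : sprod 0 z = 0.
Proof. by rewrite -[0](scale0r z) sprodZl scale0r. Qed.

Lemma sprod0r (z : M) : sprod z 0 = 0.
Proof. by rewrite sprodC sprod0l. Qed.

Lemma sprod_suml I (r : seq I) (P : pred I) (G : I -> M) z :
  sprod (\sum_(i <- r | P i) G i) z = \sum_(i <- r | P i) sprod (G i) z.
Proof.
apply: (big_morph (fun x => sprod x z)) => [x y|]; [exact: sprodDl | exact: sprod0l].
Qed.

End SymSquareTheory.

(** * Euler duality for quartic algebras with a power basis *)

Section MonogenicQuartic.
Context (R A : comPzRingType) (rho : {rmorphism R -> A}) (s : A).
Hypothesis sbasis : is_basis rho (fun i : 'I_4 => s ^+ i).

Definition qcoef (a : A) : 'I_4 -> R := projT1 (cid (sbasis a)).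

Lemma qcoefE a : a = \sum_(i < 4) rho (qcoef a i) * s ^+ i.
Proof. by rewrite /qcoef; case: cid => c []. Qed.

Lemma qcoef_uniq a c : a = \sum_(i < 4) rho (c i) * s ^+ i -> qcoef a = c.
Proof. by rewrite /qcoef; case: cid => c' [/= _ cu] /cu. Qed.

Variables (w F0 F1 F2 F3 F4 : R).
Hypothesis wF : w * F4 = 1.

(** The functional of Euler: for [F] the quartic equation of [s], of derivative [F'],
    it is the residue [a |-> \sum a / F'(s)] over the roots of [F], when [w] is the inverse of the
    leading coefficient. *)
Definition euler_fun (a : A) : R := w * qcoef a (inord 3).

Lemma euler_linear : linear (euler_fun : dirim rho -> R^o).
Proof.
move=> r a b; rewrite /euler_fun.
have -> : qcoef (r *: a + b : dirim rho) = fun i => r * qcoef a i + qcoef b i.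
  apply: qcoef_uniq; rewrite -[LHS]/(rho r * (a : A) + b : A).
  rewrite [in LHS](qcoefE a) [in LHS](qcoefE b) mulr_sumr -big_split /=.
  by apply: eq_bigr => i _; rewrite rmorphD rmorphM mulrDl mulrA.
by rewrite -[_ *: _]/(r * (w * _)); ring.
Qed.

Definition euler : {linear dirim rho -> R^o} :=
  HB.pack euler_fun
    (GRing.isLinear.Build R (dirim rho) R^o *:%R euler_fun euler_linear).

Local Notation lam := euler_fun.

Lemma eulerD (a b : A) : lam (a + b) = lam a + lam b.
Proof. exact: (linearD euler). Qed.
Lemma eulerZ r (a : A) : lam (rho r * a) = r * lam a.
Proof. exact: (linearZ_LR euler r a). Qed.
Lemma euler0 : lam 0 = 0.
Proof. exact: (linear0 euler). Qed.
Lemma eulerN (a : A) : lam (- a) = - lam a.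
Proof. exact: (linearN euler). Qed.
Lemma euler_sum I (r : seq I) (P : pred I) (G : I -> A) :
  lam (\sum_(i <- r | P i) G i) = \sum_(i <- r | P i) lam (G i).
Proof. exact: (big_morph _ eulerD euler0). Qed.

Lemma eulerX i : (i < 4)%N -> lam (s ^+ i) = if i == 3 then w else 0.
Proof.
move=> i4; rewrite /euler_fun (@qcoef_uniq _ (fun j : 'I_4 => ((j : nat) == i)%:R)).
  by rewrite inordK //= eq_sym; case: eqP => _; rewrite ?mulr1 ?mulr0.
rewrite (bigD1 (Ordinal i4)) //= eqxx rmorph1 mul1r big1 ?addr0 // => j.
by rewrite -val_eqE /= => /negPf ->; rewrite rmorph0 mul0r.
Qed.

(** In the coordinates [1, s, s^2, s^3] the pairing [(a, b) |-> lam (a * b)] is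
    antitriangular with units on the antidiagonal, hence perfect. *)
Lemma euler_nondeg (a : A) :
  (forall i, (i < 4)%N -> lam (s ^+ i * a) = 0) -> a = 0.
Proof.
have w0 (r : R) : r * w = 0 -> r = 0.
  by move=> rw; rewrite -[r]mulr1 -wF mulrA rw mul0r.
rewrite (qcoefE a); move: (qcoef a) => c z.
have {}z i : (i < 4)%N -> \sum_(j < 4) c j * lam (s ^+ (i + j)) = 0.
  move=> i4; rewrite -[RHS](z i i4) mulr_sumr euler_sum; apply: eq_bigr => j _.
  by rewrite [in RHS]mulrCA -exprD eulerZ.
suff c0 m (j : 'I_4) : (4 <= j + m)%N -> c j = 0.
  by rewrite big1 // => j _; rewrite (c0 4) ?rmorph0 ?mul0r // leq_addl.
elim: m j => [|m IHm] j jm.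
  by have := ltn_ord j; rewrite ltnNge -[X in (_ <= X)%N]addn0 jm.
have [/IHm //|] := leqP 4 (j + m).
move: jm; rewrite addnS !ltnS => jm1 jm2.
have {jm1 jm2} jm : (j + m = 3)%N by apply/eqP; rewrite eqn_leq jm1 jm2.
have m4 : (m < 4)%N by rewrite ltnS -jm leq_addl.
have := z m m4; rewrite (bigD1 j) //= big1 => [|l lj].
  by rewrite addr0 addnC jm (@eulerX 3) // => /w0.
have [lt_lj|lt_jl|/val_inj e] := ltngtP l j; last by rewrite e eqxx in lj.
- have lm : (m + l < 3)%N by rewrite addnC; apply: (@leq_trans (j + m)); rewrite ?ltn_add2r // jm.
  by rewrite eulerX ?(ltn_trans lm) // (ltn_eqF lm) mulr0.
- rewrite IHm ?mul0r //; apply: (@leq_trans (j + m).+1); first by rewrite jm.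
  by rewrite ltn_add2r.
Qed.

Hypothesis sF :
  rho F0 + rho F1 * s + rho F2 * s ^+ 2 + rho F3 * s ^+ 3 + rho F4 * s ^+ 4 = 0.

(** The Horner quotients of [F(s)], i.e. the coefficients of [F(T) / (T - s)]:
    Euler's dual basis of [1, s, s^2, s^3]. *)
Definition horner_basis (j : nat) : A :=
  match j with
  | 0 => rho F4 * s ^+ 3 + rho F3 * s ^+ 2 + rho F2 * s + rho F1
  | 1 => rho F4 * s ^+ 2 + rho F3 * s + rho F2
  | 2 => rho F4 * s + rho F3
  | _ => rho F4
  end.

(** Multiplication by [s] shifts the Horner quotients up to a constant, which [lam] does
    not see on [1, s, s^2]. *)
Lemma euler_dual i j : (i < 4)%N -> (j < 4)%N ->
  lam (s ^+ i * horner_basis j) = (i == j)%:R.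
Proof.
have lam3 (a b c d : R) :
    lam (rho a * s ^+ 3 + rho b * s ^+ 2 + rho c * s ^+ 1 + rho d * s ^+ 0) = a * w.
  by rewrite !eulerD !eulerZ !eulerX //= !mulr0 !addr0.
have e0 l : (l < 4)%N -> lam (horner_basis l) = (l == 0)%:R.
  case: l => [|[|[|[|//]]]] _.
  - by rewrite -[RHS]wF [RHS]mulrC -(lam3 F4 F3 F2 F1) expr0 mulr1.
  - by rewrite -[RHS](mul0r w) -(lam3 0 F4 F3 F2) rmorph0 mul0r add0r expr0 mulr1.
  - rewrite -[RHS](mul0r w) -(lam3 0 0 F4 F3).
    by rewrite rmorph0 !mul0r !add0r expr0 mulr1.
  - rewrite -[RHS](mul0r w) -(lam3 0 0 0 F4).
    by rewrite rmorph0 !mul0r !add0r expr0 mulr1.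
have step i' l : (i' < 3)%N -> (l < 4)%N -> lam (s ^+ i'.+1 * horner_basis l) =
    if l is l'.+1 then lam (s ^+ i' * horner_basis l') else 0.
  move=> i3 l4; have Xi : lam (s ^+ i') = 0.
    by rewrite eulerX ?(ltn_trans i3) // (ltn_eqF i3).
  have shift (G : R) b : s * horner_basis l = b - rho G ->
      lam (s ^+ i'.+1 * horner_basis l) = lam (s ^+ i' * b).
    move=> e; rewrite exprSr -mulrA e mulrBr eulerD eulerN.
    by rewrite [s ^+ i' * rho _]mulrC eulerZ Xi mulr0 subr0.
  case: l l4 shift => [|[|[|[|//]]]] _ shift.
  - by rewrite (shift F0 0) ?mulr0 ?euler0 // -sF /=; ring.
  - by apply: (shift F1) => /=; ring.
  - by apply: (shift F2) => /=; ring.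
  - by apply: (shift F3) => /=; ring.
elim: i j => [|i IHi] j i4 j4; first by rewrite expr0 mul1r e0 // eq_sym.
rewrite step //; case: j j4 => // j j4.
by rewrite IHi //; exact: ltnW.
Qed.

Lemma euler_horner_sum (r : nat -> R) i : (i < 4)%N ->
  lam (s ^+ i * \sum_(j < 4) rho (r j) * horner_basis j) = r i.
Proof.
move=> i4; rewrite mulr_sumr euler_sum (bigD1 (Ordinal i4)) //= big1 => [|j].
  by rewrite addr0 mulrCA eulerZ euler_dual // eqxx mulr1.
rewrite -val_eqE /= => ji; rewrite mulrCA eulerZ euler_dual //.
by rewrite eq_sym (negPf ji) mulr0.
Qed.

Lemma euler_expand (a : A) :
  a = \sum_(j < 4) rho (lam (s ^+ j * a)) * horner_basis j.
Proof.
apply/eqP; rewrite -subr_eq0; apply/eqP/euler_nondeg => i i4.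
rewrite mulrBr eulerD eulerN.
by rewrite (euler_horner_sum (fun j => lam (s ^+ j * a))) // subrr.
Qed.

Lemma horner_is_basis : is_basis rho (fun j : 'I_4 => horner_basis j).
Proof.
move=> a; exists (fun j : 'I_4 => lam (s ^+ j * a)); split.
  exact: euler_expand.
move=> c ac; apply/funext => i; rewrite ac.
rewrite [X in s ^+ i * X](_ : _ = \sum_(j < 4) rho (c (inord j)) * horner_basis j).
  by rewrite (euler_horner_sum (c \o inord)) //= inord_val.
by apply: eq_bigr => j _; rewrite inord_val.
Qed.

Lemma euler_generator : is_generator euler.
Proof.
move=> psi; exists (\sum_(j < 4) rho (psi (s ^+ j)) * horner_basis j).
have psiE (a : A) : psi a = \sum_i qcoef a i * psi (s ^+ i).
  rewrite [in LHS](qcoefE a) (linear_sum psi); apply: eq_bigr => i _.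
  exact: (linearZ_LR psi (qcoef a i) (s ^+ i)).
have bs i : (i < 4)%N ->
    lam (s ^+ i * \sum_(j < 4) rho (psi (s ^+ j)) * horner_basis j) = psi (s ^+ i).
  exact: (euler_horner_sum (fun j => psi (s ^+ j))).
split=> [a|b' b'P].
  rewrite psiE -[RHS]/(lam _) [in RHS](qcoefE a) mulr_sumr euler_sum.
  apply: eq_bigr => i _.
  by rewrite mulrCA eulerZ [_ * s ^+ i]mulrC bs.
apply/eqP; rewrite -subr_eq0; apply/eqP/euler_nondeg => i i4.
by rewrite mulrBr eulerD eulerN bs // [_ * b']mulrC b'P -/(lam _) subrr.
Qed.

End MonogenicQuartic.

(** * Moments and the copairing *)

Section FFTheory.
Context (R A : comPzRingType) (rho : {rmorphism R -> A}).

Lemma FFprD (a b : A) : FFpr rho (a + b) = FFpr rho a + FFpr rho b.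
Proof. exact: (linearD (quot_pr (M := dirim rho) [set (1 : A)])). Qed.

Lemma FFprZ r (a : A) : FFpr rho (rho r * a) = r *: FFpr rho a.
Proof. exact: (linearZ_LR (quot_pr (M := dirim rho) [set (1 : A)]) r a). Qed.

Lemma FFpr_sum I (r : seq I) (P : pred I) (G : I -> A) :
  FFpr rho (\sum_(i <- r | P i) G i) = \sum_(i <- r | P i) FFpr rho (G i).
Proof. exact: (linear_sum (quot_pr (M := dirim rho) [set (1 : A)])). Qed.

Lemma FFpr_const r : FFpr rho (rho r) = 0.
Proof.
rewrite -[rho r]mulr1 FFprZ [X in _ *: X](_ : _ = 0) ?scaler0 //.
exact: (quot_pr_gen (M := dirim rho)).
Qed.

(** The element [\sum_m e_m (x) f_m] is the diagonal for the pairing of [lam'], so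
    testing [\sum_m b e_m (x) f_m] against functionals [lam' (c -)] and [lam' (d -)] only
    sees [b c d]. Any [lam] is [lam' (g -)] for some [g]. *)
Lemma copairing_test n (lam lam' : {linear dirim rho -> R^o}) (e f : 'I_n -> A) :
    is_generator lam' -> is_basis rho e ->
    (forall i j, lam' (e i * f j : A) = (i == j)%:R) ->
  exists g : A, forall b c d : A,
    \sum_m (lam (c * (b * e m) : A) : R) * lam (d * f m : A) = lam (g * b * (c * d) : A).
Proof.
move=> gen ebasis ef; have [g [lamE _]] := gen lam; exists g => b c d.
have lam'Z r y : lam' (rho r * y : A) = r * lam' y :> R.
  exact: (linearZ_LR lam' r y).
have lam'S (G : 'I_n -> A) : lam' (\sum_m G m : A) = \sum_m (lam' (G m) : R) :> R.
  exact: (linear_sum lam').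
have dual y : y = \sum_m rho (lam' (y * f m : A)) * e m.
  have [a [yE _]] := ebasis y; rewrite [LHS]yE; apply: eq_bigr => m _.
  congr (rho _ * _); rewrite yE mulr_suml lam'S (bigD1 m) //= big1 => [|l lm].
    by rewrite addr0 -mulrA lam'Z ef eqxx mulr1.
  by rewrite -mulrA lam'Z ef (negPf lm) mulr0.
transitivity (lam' (g * (c * b) * \sum_m rho (lam' (g * d * f m : A)) * e m : A)).
  rewrite mulr_sumr lam'S; apply: eq_bigr => m _.
  by rewrite [in RHS]mulrCA lam'Z [LHS]mulrC !lamE; congr (lam' _ * lam' _); ring.
by rewrite -dual !lamE; congr (lam' _); ring.
Qed.
End FFTheory.

Section NetOnChart.
Context (R A : comPzRingType) (rho : {rmorphism R -> A}) (s : A).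
Hypothesis sbasis : is_basis rho (fun i : 'I_4 => s ^+ i).
Variables (w F0 F1 F2 F3 F4 : R).
Hypothesis wF : w * F4 = 1.

Local Notation lam := (euler_fun sbasis w).
Local Notation hb := (horner_basis rho s F1 F2 F3 F4).

(** The moments of a function; for [i < 3] they vanish on [R], and they are the
    coordinates of an isomorphism from [A / R] to [R^3]. *)
Definition theta_fun (i : nat) (a : A) : R := lam (s ^+ i * a).

Lemma theta_linear i : linear (theta_fun i : dirim rho -> R^o).
Proof.
move=> r a b; rewrite /theta_fun -[r *: a + b]/(rho r * (a : A) + (b : A)).
by rewrite mulrDr eulerD mulrCA eulerZ.
Qed.

Definition theta_dirim i : {linear dirim rho -> R^o} :=
  HB.pack (theta_fun i : dirim rho -> R^o)
    (GRing.isLinear.Build R (dirim rho) R^o *:%R (theta_fun i) (@theta_linear i)).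

Lemma theta_const (i : 'I_3) (a : dirim rho) :
  [set (1 : A) : dirim rho]%classic a -> theta_dirim i a = 0.
Proof.
move=> ->; rewrite -[LHS]/(lam (s ^+ i * 1)) mulr1 eulerX ?(ltn_trans (ltn_ord i)) //.
by rewrite (ltn_eqF (ltn_ord i)).
Qed.

Definition theta (i : 'I_3) : {linear FF rho -> R^o} :=
  quot_lift (@theta_const i).

Lemma thetaE i a : theta i (FFpr rho a) = lam (s ^+ i * a) :> R.
Proof. exact: (quot_liftE (@theta_const i) a). Qed.

Lemma thetaP i a x y : theta i (a *: x + y) = a * (theta i x : R) + theta i y :> R.
Proof. exact: (linearP (theta i)). Qed.

Hypothesis sF :
  rho F0 + rho F1 * s + rho F2 * s ^+ 2 + rho F3 * s ^+ 3 + rho F4 * s ^+ 4 = 0.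

Lemma FF_expand (x : FF rho) :
  x = \sum_(j < 3) (theta j x : R) *: FFpr rho (hb j).
Proof.
case: (quot_pr_surj x) => a ->; rewrite -/(FFpr rho a).
rewrite {1}(euler_expand sbasis wF sF a) big_ord_recr FFprD -[hb ord_max]/(rho F4).
rewrite -rmorphM FFpr_const addr0.
by rewrite FFpr_sum; apply: eq_bigr => j _; rewrite FFprZ thetaE.
Qed.

Lemma theta_dual (i j : 'I_3) : theta i (FFpr rho (hb j)) = (i == j)%:R :> R.
Proof.
by rewrite thetaE (euler_dual sbasis wF sF) // (ltn_trans (ltn_ord _)).
Qed.

Lemma theta_inj x y : (forall i, theta i x = theta i y) -> x = y.
Proof.
move=> xy; rewrite (FF_expand x) (FF_expand y).
by apply: eq_bigr => i _; rewrite xy.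
Qed.

Definition theta_inv (r : 'I_3 -> R) : FF rho :=
  \sum_(j < 3) r j *: FFpr rho (hb j).

Lemma theta_invK r i : theta i (theta_inv r) = r i :> R.
Proof.
have thZ j : theta i (r j *: FFpr rho (hb j)) = r j * (i == j)%:R :> R.
  by rewrite -theta_dual; exact: (linearZ_LR (theta i)).
rewrite [LHS](linear_sum (theta i)) (bigD1 i) // big1 => [|j ji].
  by rewrite [LHS]addr0 thZ eqxx mulr1.
by rewrite thZ eq_sym (negPf ji) mulr0.
Qed.

Section NetForm.
Variable (B : 'I_3 -> 'I_3 -> R).
Hypothesis Bsym : forall i j, B i j = B j i.

Definition netform_fun (x y : FF rho) : R^o :=
  \sum_i \sum_j B i j * ((theta i x : R) * (theta j y : R)).

Lemma netform_bilinear : sym_bilinear netform_fun.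
Proof.
split=> [x y|a x y z]; rewrite /netform_fun.
  rewrite exchange_big /=; apply: eq_bigr => i _; apply: eq_bigr => j _.
  by rewrite Bsym; congr (_ * _); rewrite mulrC.
transitivity (\sum_i \sum_j (a * (B i j * ((theta i x : R) * (theta j z : R)))
    + B i j * ((theta i y : R) * (theta j z : R)))).
  by do 2!apply: eq_bigr => ? _; rewrite thetaP; ring.
rewrite -[RHS]/(a * _ + _) mulr_sumr -big_split; apply: eq_bigr => i _.
by rewrite mulr_sumr -big_split.
Qed.

Definition netform : {linear Sym2 (FF rho) -> R^o} := sym2_lift netform_bilinear.

Lemma netformE x y :
  netform (sprod x y) = \sum_i \sum_j B i j * ((theta i x : R) * (theta j y : R)) :> R.
Proof. exact: (sym2_liftE netform_bilinear). Qed.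

Hypothesis Bs : \sum_i \sum_j rho (B i j) * s ^+ (i + j) = 0.

(** On a copairing the quadratic form [B] takes the value [lam (g b B(s))], where [B(s)]
    is its value at the point [(1, s, s^2)]. *)
Lemma netform_copairing t : copairing_image t -> netform t = 0.
Proof.
move=> [n [lam' [e [f [b [gen ebasis _ ef ->]]]]]].
have [g tst] := copairing_test (euler sbasis w) gen ebasis ef.
rewrite (linear_sum netform).
transitivity (\sum_i \sum_j \sum_m B i j * (lam (s ^+ i * (b * e m)) * lam (s ^+ j * f m))).
  rewrite [RHS](eq_bigr _ (fun i _ => exchange_big _ _ _ _ _ _)) exchange_big.
  by apply: eq_bigr => m _; rewrite netformE; do 2!apply: eq_bigr => ? _; rewrite !thetaE.
transitivity (lam (g * b * (\sum_i \sum_j rho (B i j) * s ^+ (i + j)))); last first.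
  by rewrite Bs mulr0 euler0.
rewrite mulr_sumr euler_sum; apply: eq_bigr => i _.
rewrite mulr_sumr euler_sum; apply: eq_bigr => j _.
by rewrite -mulr_sumr [X in _ * X]tst [in RHS]mulrCA eulerZ exprD.
Qed.

Definition netform_QQ : {linear QQ rho -> R^o} := quot_lift netform_copairing.

Lemma netform_QQE t : netform_QQ (QQpr t) = netform t.
Proof. exact: quot_liftE. Qed.
End NetForm.
End NetOnChart.

(** * Quadratic forms detecting the copairing *)

Section Exactness.
Context (R A : comPzRingType) (rho : {rmorphism R -> A}) (s : A).
Hypothesis sbasis : is_basis rho (fun i : 'I_4 => s ^+ i).
Variables (w F0 F1 F2 F3 F4 : R).
Hypothesis wF : w * F4 = 1.
Hypothesis sF :
  rho F0 + rho F1 * s + rho F2 * s ^+ 2 + rho F3 * s ^+ 3 + rho F4 * s ^+ 4 = 0.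

Local Notation lam := (euler_fun sbasis w).
Local Notation hb := (horner_basis rho s F1 F2 F3 F4).
Local Notation gg i j := (sprod (FFpr rho (hb i)) (FFpr rho (hb j))).
Local Notation netform := (netform sbasis w).

Lemma sym2_FF_expand (half : R) (t : Sym2 (FF rho)) : half *+ 2 = 1 ->
  exists2 c : 'I_3 -> 'I_3 -> R, (forall i j, c i j = c j i) &
    t = \sum_(i < 3) \sum_(j < 3) c i j *: gg i j.
Proof.
move=> half2.
suff [c ->] : exists c : 'I_3 -> 'I_3 -> R, t = \sum_(i < 3) \sum_(j < 3) c i j *: gg i j.
  exists (fun i j => half * (c i j + c j i)) => [i j|]; first by rewrite addrC.
  pose S := \sum_(i < 3) \sum_(j < 3) c j i *: gg i j.
  have SE : S = \sum_(i < 3) \sum_(j < 3) c i j *: gg i j.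
    rewrite /S exchange_big; apply: eq_bigr => i _; apply: eq_bigr => j _.
    by rewrite sprodC.
  transitivity (half *: (S + S)).
    by rewrite -mulr2n -scalerMnr scalerMnl half2 scale1r.
  rewrite {1}SE /S -big_split scaler_sumr; apply: eq_bigr => i _.
  rewrite -big_split scaler_sumr; apply: eq_bigr => j _.
  by rewrite -[X in half *: X]scalerDl scalerA.
move: t; apply: sym2_ind => [|x y].
  split=> [|a x y [c ->] [d ->]].
    exists (fun _ _ => 0); rewrite big1 // => i _; rewrite big1 // => j _.
    by rewrite scale0r.
  exists (fun i j => a * c i j + d i j); rewrite scaler_sumr -big_split.
  apply: eq_bigr => i _; rewrite scaler_sumr -big_split; apply: eq_bigr => j _.
  by rewrite scalerDl scalerA.
exists (fun i j => (theta sbasis w i x : R) * theta sbasis w j y).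
rewrite {1}(FF_expand sbasis wF sF x) sprod_suml; apply: eq_bigr => i _.
rewrite {1}(FF_expand sbasis wF sF y) sprodC sprod_suml; apply: eq_bigr => j _.
by rewrite sprodZl sprodZr scalerA mulrC sprodC.
Qed.

Lemma netform_expand (B c : 'I_3 -> 'I_3 -> R) (Bsym : forall i j, B i j = B j i) :
  netform Bsym (\sum_(i < 3) \sum_(j < 3) c i j *: gg i j) =
    \sum_(i < 3) \sum_(j < 3) c i j * B i j :> R.
Proof.
rewrite (linear_sum (netform Bsym)); apply: eq_bigr => i _.
rewrite (linear_sum (netform Bsym)); apply: eq_bigr => j _.
rewrite (linearZ_LR (netform Bsym)) netformE; congr (_ * _).
transitivity (\sum_(l < 3) \sum_(m < 3) B l m * ((l == i)%:R * (m == j)%:R)).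
  by do 2!apply: eq_bigr => ? _; rewrite !(theta_dual sbasis wF sF).
rewrite (bigD1 i) //= [X in _ + X]big1 ?addr0 => [|l /negPf li]; last first.
  by rewrite big1 // => m _; rewrite li mul0r mulr0.
rewrite (bigD1 j) //= [X in _ + X]big1 ?addr0 => [|m /negPf mj].
  by rewrite !eqxx !mulr1.
by rewrite mj !mulr0.
Qed.

Lemma copairing_imageP (b : A) : copairing_image
  (\sum_(i < 3) \sum_(j < 3) lam (s ^+ (i + j) * b) *: gg i j).
Proof.
exists 4, (euler sbasis w), (fun i : 'I_4 => s ^+ i), (fun i : 'I_4 => hb i), b.
split.
- exact: euler_generator wF sF.
- exact: sbasis.
- exact: horner_is_basis wF sF.
- by move=> i j; rewrite -[LHS]/(lam _) (euler_dual sbasis wF sF).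
rewrite [RHS]big_ord_recr -[hb ord_max]/(rho F4) FFpr_const sprod0r [RHS]addr0.
rewrite exchange_big; apply: eq_bigr => j _.
rewrite (FF_expand sbasis wF sF (FFpr rho (b * _))).
rewrite sprod_suml; apply: eq_bigr => i _; rewrite sprodZl thetaE.
by congr (lam _ *: _); rewrite exprD; ring.
Qed.

(** In the basis dual to [1, s, s^2] the form [Bxi] vanishes on a symmetric tensor
    exactly when it is a Hankel matrix [c i j = r (i + j)], and the copairing image
    consists of the Hankel tensors [r d = lam (s^d b)]; since [lam] is perfect on
    [1, s, s^2, s^3], the only constraint on [r] is the linear relation
    [\sum_d F_d r_d = 0] coming from [F(s) = 0], i.e. the vanishing of [B]. *)
Lemma netform_exact (half kappa kappaV : R) (Bxi B : 'I_3 -> 'I_3 -> R)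
    (Bxi_sym : forall i j, Bxi i j = Bxi j i) (B_sym : forall i j, B i j = B j i) t :
    half *+ 2 = 1 -> kappaV * kappa = 1 ->
    (forall i j : 'I_3, Bxi i j =
       if (i + j == 2)%N then (if i == 1 :> nat then - (kappa *+ 2) else kappa) else 0) ->
    (forall r : nat -> R, \sum_(i < 3) \sum_(j < 3) r (i + j)%N * B i j =
       r 0 * F0 + r 1 * F1 + r 2 * F2 + r 3 * F3 + r 4 * F4) ->
  netform Bxi_sym t = 0 -> netform B_sym t = 0 -> QQpr t = 0.
Proof.
move=> half2 kappaVK BxiE BE; have [c csym ->] := sym2_FF_expand t half2.
rewrite !netform_expand => xi0 B0.
pose i0 : 'I_3 := ord0; pose i1 : 'I_3 := lift ord0 ord0.
pose i2 : 'I_3 := lift ord0 (lift ord0 ord0).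
have c02 : c i0 i2 = c i1 i1.
  move: xi0; rewrite !big_ord_recl !big_ord0 !BxiE /= /bump /= !mulr0 !(add0r, addr0).
  rewrite -/i0 -/i1 -/i2 (csym i2 i0) => xi0.
  apply/eqP; rewrite -subr_eq0 -[X in X == 0](mul1r) -half2 -[X in X * _]mulr1 -kappaVK.
  by rewrite -(mulr0 (half * kappaV)) -xi0; apply/eqP; ring.
pose r d := nth 0 [:: c i0 i0; c i0 i1; c i1 i1; c i1 i2; c i2 i2] d.
have cr i j : c i j = r (i + j)%N.
  have I3 (l : 'I_3) : [\/ l = i0, l = i1 | l = i2].
    by case: l => [[|[|[|//]]] l3]; [apply: Or31|apply: Or32|apply: Or33]; apply: val_inj.
  by case: (I3 i) => ->; case: (I3 j) => ->;
    first [exact: erefl | exact: csym | exact: c02 | exact: etrans (csym _ _) c02].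
have rF : r 0 * F0 + r 1 * F1 + r 2 * F2 + r 3 * F3 + r 4 * F4 = 0.
  by rewrite -BE -[RHS]B0; do 2!apply: eq_bigr => ? _; rewrite cr.
pose b := \sum_(d < 4) rho (r d) * hb d.
have br d : (d < 5)%N -> lam (s ^+ d * b) = r d.
  have br4 e : (e < 4)%N -> lam (s ^+ e * b) = r e.
    exact: (euler_horner_sum sbasis wF sF).
  (* The moment of order 4 is determined by the other ones through [F(s) b = 0]. *)
  rewrite ltnS leq_eqVlt => /orP[/eqP ->|]; last exact: br4.
  have : lam ((rho F0 + rho F1 * s + rho F2 * s ^+ 2 + rho F3 * s ^+ 3 +
               rho F4 * s ^+ 4) * b) = 0 by rewrite sF mul0r euler0.
  rewrite -[rho F0]mulr1 -(expr0 s) -[in rho F1 * s](expr1 s).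
  rewrite !mulrDl !eulerD -!(mulrA (rho _)) !eulerZ.
  rewrite (br4 0) // (br4 1) // (br4 2) // (br4 3) // => e.
  have F4E : F4 * lam (s ^+ 4 * b) = F4 * r 4.
    apply: (@addrI _ (F0 * r 0 + F1 * r 1 + F2 * r 2 + F3 * r 3)).
    by rewrite e -rF; ring.
  by rewrite -[LHS]mul1r -[RHS]mul1r -wF -[LHS]mulrA -[RHS]mulrA F4E.
rewrite [X in QQpr X](_ : _ =
    \sum_(i < 3) \sum_(j < 3) lam (s ^+ (i + j) * b) *: gg i j).
  exact: quot_pr_gen (copairing_imageP b).
by do 2!apply: eq_bigr => ? _; rewrite br ?cr // (@leq_ltn_trans (2 + 2)) // leq_add // -ltnS.
Qed.
End Exactness.

(** * Change of chart for the Euler functional *)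

Section Transport.
Context (R A R' A' : comPzRingType).
Context (rho : {rmorphism R -> A}) (rho' : {rmorphism R' -> A'}).
Context (r : {rmorphism R -> R'}) (t : {rmorphism A -> A'}).
Hypothesis rt : forall a, t (rho a) = rho' (r a).
Variables (s : A) (s' : A').
Hypothesis sbasis : is_basis rho (fun i : 'I_4 => s ^+ i).
Hypothesis sbasis' : is_basis rho' (fun i : 'I_4 => s' ^+ i).
Variables (w : R) (w' : R').

(** Both sides are semilinear along [r], so the power basis decides; the factor [c]
    leaves room for a change of trivialisation of the canonical module. *)
Lemma euler_transport (c : A') :
  (forall i, (i < 4)%N ->
     euler_fun sbasis' w' (c * t (s ^+ i)) = r (euler_fun sbasis w (s ^+ i))) ->
  forall a, euler_fun sbasis' w' (c * t a) = r (euler_fun sbasis w a).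
Proof.
move=> ci a; rewrite (qcoefE sbasis a) rmorph_sum mulr_sumr !euler_sum rmorph_sum.
apply: eq_bigr => i _.
by rewrite rmorphM rt mulrCA !eulerZ ci // rmorphM.
Qed.
End Transport.

(** * Polynomials over an algebraically closed field *)

Section ClosedFieldPolynomials.
Variable k : closedFieldType.
Implicit Types p q P Q W N : {poly k}.

Lemma poly_eq0_on_open W p : W != 0 ->
  (forall a, W.[a] != 0 -> p.[a] = 0) -> p = 0.
Proof.
move=> W0 pW; apply/eqP/negPn/negP => p0.
have : p * W != 0 by rewrite mulf_neq0.
case/closed_nonrootP => a; rewrite /root hornerM mulf_eq0 negb_or => /andP[pa Wa].
by rewrite (pW a Wa) eqxx in pa.
Qed.

Lemma dvdp_exp_roots Q W : Q != 0 -> (forall a, Q.[a] = 0 -> W.[a] = 0) ->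
  exists n, Q %| W ^+ n.
Proof.
have [n] := ubnP (size Q); elim: n Q => // n IHn Q sQ Q0 QW.
have [sQ1|/closed_rootP[a Qa]] := eqVneq (size Q) 1.
  by exists 0%N; rewrite dvdUp // -size_poly_eq1 sQ1.
have [Q1 QE] : exists Q1, Q = Q1 * ('X - a%:P) by exact/factor_theorem.
have Q10 : Q1 != 0 by apply: contraNneq Q0 => Q10; rewrite QE Q10 mul0r.
have [|//||m Q1W] := IHn Q1.
- by move: sQ; rewrite QE size_Mmonic ?monicXsubC // size_XsubC addn2.
- by move=> b Q1b; apply: QW; rewrite QE hornerM Q1b mul0r.
exists m.+1; rewrite QE exprSr dvdp_mul // dvdp_XsubCl.
by apply/rootP/QW/rootP.
Qed.

(** The polynomials [Q] such that [Q g] is a polynomial form an ideal. As any point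
    outside the zeros of [W] is avoided by some member, a generator has its roots among
    those of [W], hence divides a power of [W]. *)
Lemma local_fraction W (g : k -> k) : W != 0 ->
    (forall a, W.[a] != 0 -> exists P Q, Q.[a] != 0 /\
       forall b, W.[b] != 0 -> Q.[b] != 0 -> g b = P.[b] / Q.[b]) ->
  exists N n, forall b, W.[b] != 0 -> g b = N.[b] / W.[b] ^+ n.
Proof.
move=> W0 gloc.
pose den Q := exists P, forall b, W.[b] != 0 -> Q.[b] * g b = P.[b].
have denP a : W.[a] != 0 -> exists2 Q, den Q & Q.[a] != 0.
  move=> /gloc[P [Q [Qa gE]]]; exists (Q ^+ 2); last by rewrite horner_exp expf_neq0.
  exists (P * Q) => b Wb; rewrite horner_exp hornerM.
  have [->|Qb] := eqVneq Q.[b] 0; first by rewrite expr0n !mulr0 mul0r.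
  by rewrite gE //; field.
have den_lin u v Q Q' : den Q -> den Q' -> den (u * Q + v * Q').
  move=> [P gP] [P' gP']; exists (u * P + v * P') => b Wb.
  by rewrite !hornerE mulrDl -!mulrA gP // gP'.
have [Q [Qden Q0 Qroots]] :
    exists Q, [/\ den Q, Q != 0 & forall a, Q.[a] = 0 -> W.[a] = 0].
  have [a Wa] := closed_nonrootP _ W0.
  have [Q Qden Qa] := denP a Wa.
  have Q0 : Q != 0 by apply: contraNneq Qa => ->; rewrite horner0.
  have [n] := ubnP (size Q); elim: n Q {Qa} Qden Q0 => // n IHn Q Qden Q0 sQ.
  have [Qroots|] := pselect (forall a, Q.[a] = 0 -> W.[a] = 0); first by exists Q.
  move=> /existsNP[z] /not_implyP[Qz /eqP Wz].
  have [Q' Q'den Q'z] := denP z Wz.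
  have [[u' v'] /= uv'] := Bezoutp Q Q'.
  have gden := den_lin u' v' _ _ Qden Q'den.
  have g0 : u' * Q + v' * Q' != 0.
    by rewrite -size_poly_eq0 (eqp_size uv') size_poly_eq0 gcdp_eq0 negb_and Q0.
  apply: IHn gden g0 _; rewrite (eqp_size uv').
  rewrite ltnS in sQ; apply: leq_trans sQ; rewrite ltn_neqAle (dvdp_leq Q0 (dvdp_gcdl _ _)) andbT.
  apply/eqP => sg; have := dvdp_gcdr Q Q'.
  have /eqp_dvdl -> : gcdp Q Q' %= Q by rewrite -dvdp_size_eqp ?sg // dvdp_gcdl.
  move=> /dvdpP[c Q'E]; move/eqP: Q'z; apply.
  by rewrite Q'E hornerM Qz mulr0.
have [n /dvdpP[U WE]] := dvdp_exp_roots Q0 Qroots.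
have [P gP] := Qden.
exists (U * P), n => b Wb; rewrite hornerM -gP // -horner_exp WE hornerM.
have UQ0 : U.[b] * Q.[b] != 0 by rewrite -hornerM -WE horner_exp expf_neq0.
by rewrite mulrA mulrC mulKf.
Qed.

Section Independence.
Variables p0 p1 : {poly k}.
Hypotheses (p01 : coprimep p0 p1) (p1_size : size p1 = 5).

(** Modulo [p1] only the term [j = 0] survives, so [p1] divides [c 0], whose degree is
    smaller; then [p1] can be divided out. *)
Lemma base_expansion_uniq m (c : nat -> {poly k}) : (forall j, size (c j) <= 4)%N ->
  \sum_(j < m) c j * p1 ^+ j * p0 ^+ (m - j) = 0 -> forall j, (j < m)%N -> c j = 0.
Proof.
elim: m c => // m IHm c csz; rewrite big_ord_recl expr0 mulr1 subn0.
set S := \sum_(i < m) _.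
have -> : S = p1 * \sum_(j < m) c j.+1 * p1 ^+ j * p0 ^+ (m - j).
  rewrite mulr_sumr; apply: eq_bigr => j _.
  by rewrite lift0 subSS exprS; ring.
move=> eS.
have p10 : p1 != 0 by rewrite -size_poly_eq0 p1_size.
have c0 : c 0 = 0.
  apply/eqP/negPn/negP => c00.
  have : p1 %| c 0 * p0 ^+ m.+1.
    by rewrite -[_ * _](addrK (p1 * \sum_(j < m) c j.+1 * p1 ^+ j * p0 ^+ (m - j)))
       eS sub0r dvdpNr dvdp_mulIl.
  rewrite Gauss_dvdpl; last by rewrite coprimep_sym coprimep_expl.
  by move/(dvdp_leq c00); rewrite p1_size ltnNge csz.
move: eS; rewrite c0 mul0r add0r => /eqP; rewrite mulf_eq0 (negPf p10) /= => /eqP eS.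
by case=> // j; rewrite ltnS; apply: (IHm (fun j => c j.+1)).
Qed.

(** [k(s)] has degree 4 over [k(p1 / p0)], with basis [1, s, s^2, s^3]. *)
Lemma fraction_powers_free W (N : 'I_4 -> {poly k}) : W != 0 ->
    (forall a, W.[a] != 0 -> p0.[a] != 0) ->
    (forall a, W.[a] != 0 -> \sum_i (N i).[p1.[a] / p0.[a]] * a ^+ i = 0) ->
  forall i, N i = 0.
Proof.
move=> W0 Wp0 NW.
pose m := (\max_i size (N i))%N.
pose c j : {poly k} := \poly_(i < 4) (N (inord i))`_j.
have cE (j : nat) a : (c j).[a] = \sum_(i < 4) (N i)`_j * a ^+ i.
  by rewrite horner_poly; apply: eq_bigr => i _; rewrite inord_val.
have NE i x : (N i).[x] = \sum_(j < m) (N i)`_j * x ^+ j.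
  rewrite (horner_coef_wide _ (_ : size (N i) <= m)%N) //.
  exact: (leq_bigmax i).
have c0 : forall j, (j < m)%N -> c j = 0.
  apply: base_expansion_uniq => [j|]; first exact: size_poly.
  apply: (poly_eq0_on_open W0) => a Wa.
  have p0a := Wp0 a Wa.
  transitivity (p0.[a] ^+ m * \sum_i (N i).[p1.[a] / p0.[a]] * a ^+ i); last first.
    by rewrite NW // mulr0.
  rewrite horner_sum mulr_sumr.
  transitivity (\sum_(j < m) \sum_(i < 4)
      (N i)`_j * a ^+ i * p1.[a] ^+ j * p0.[a] ^+ (m - j)).
    by apply: eq_bigr => j _; rewrite !hornerM cE !horner_exp !mulr_suml.
  rewrite exchange_big; apply: eq_bigr => i _.
  rewrite NE mulr_suml mulr_sumr; apply: eq_bigr => j _ /=.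
  have -> : p0.[a] ^+ m = p0.[a] ^+ (m - j) * p0.[a] ^+ j.
    by rewrite -exprD subnK // ltnW.
  by rewrite expr_div_n; field; rewrite expf_neq0.
move=> i; apply/polyP => j; rewrite coef0.
have [jm|mj] := ltnP j m; last first.
  by rewrite nth_default // (leq_trans _ mj) // (leq_bigmax i).
by have := congr1 (fun p : {poly k} => p`_i) (c0 j jm); rewrite coef_poly ltn_ord inord_val coef0.
Qed.
End Independence.

(** A section of [O(d)] on the projective line is a polynomial on each standard chart,
    with transition function [x ^ d]; clearing the denominators bounds its degree. *)
Lemma laurent_size d P Q :
  (forall a, a != 0 -> P.[a] = a ^+ d * Q.[a^-1]) -> (size P <= d.+1)%N.
Proof.
move=> PQ; pose m := size Q.
have [->|P0] := eqVneq P 0; first by rewrite size_poly0.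
have : P * 'X^m = 'X^d * \poly_(j < m.+1) Q`_(m - j).
  apply/eqP; rewrite -subr_eq0; apply/eqP; apply: (@poly_eq0_on_open 'X) => [|a].
    by rewrite polyX_eq0.
  rewrite hornerX => a0; rewrite hornerD hornerN !hornerM !hornerXn PQ //.
  rewrite horner_poly (@horner_coef_wide _ m.+1) ?leqnSn //.
  apply/eqP; rewrite subr_eq0; apply/eqP; rewrite -!mulrA; congr (_ * _).
  rewrite mulr_suml (reindex_inj rev_ord_inj) /=; apply: eq_bigr => j _.
  rewrite subSS; have jm : (j <= m)%N by rewrite -ltnS.
  rewrite -[in X in _ * X = _](subnK jm) exprD exprVn.
  by field; rewrite expf_neq0.
move=> /(congr1 (size \o val)) /= e.
have : (size (P * 'X^m)%R <= m + d.+1)%N.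
  rewrite e; apply: leq_trans (size_polyMleq _ _) _.
  by rewrite size_polyXn addSn /= addnC addnS -addSn leq_add2r size_poly.
by rewrite size_Mmonic ?monicXn // size_polyXn addnS /= addnC leq_add2l.
Qed.
End ClosedFieldPolynomials.

(** * Regular functions on rational cones *)

Section RegTheory.
Context (k : fieldType) (E : lmodType k) (D : set E).
Implicit Types (f g : reg D) (v : D).

Lemma regD f g v : (f + g) v = f v + g v. Proof. by []. Qed.
Lemma regM f g v : (f * g) v = f v * g v. Proof. by []. Qed.
Lemma reg0 v : (0 : reg D) v = 0. Proof. by []. Qed.
Lemma reg1 v : (1 : reg D) v = 1. Proof. by []. Qed.
Lemma regX f n v : (f ^+ n) v = f v ^+ n.
Proof. by elim: n => [|n IHn]; rewrite ?expr0 // !exprS regM IHn. Qed.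
Lemma reg_sum I (r : seq I) (P : pred I) (G : I -> reg D) v :
  (\sum_(i <- r | P i) G i) v = \sum_(i <- r | P i) G i v.
Proof. exact: (big_morph (fun f : reg D => f v)). Qed.

Lemma form_scale d (P : E -> k) c (e : E) : Defs.form d P -> P (c *: e) = c ^+ d * P e.
Proof.
elim=> {d P} [a|l|d p q _ ip _ iq|d1 d2 p q _ ip _ iq].
- by rewrite mul1r.
- by rewrite linearZ.
- by rewrite ip iq mulrDr.
- by rewrite ip iq exprD; ring.
Qed.

Lemma form_horner (h : k -> E) :
    (forall l : {scalar E}, exists p : {poly k}, forall a, l (h a) = p.[a]) ->
  forall d P, Defs.form d P -> exists p : {poly k}, forall a, P (h a) = p.[a].
Proof.
move=> hp d P; elim=> {d P} [a|l|d p q _ [p' ip] _ [q' iq]|d1 d2 p q _ [p' ip] _ [q' iq]].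
- by exists a%:P => b; rewrite hornerC.
- exact: hp.
- by exists (p' + q') => a; rewrite hornerD ip iq.
- by exists (p' * q') => a; rewrite hornerM ip iq.
Qed.

Lemma reg_scale (g : reg D) v w c : c != 0 -> val v = c *: val w -> g v = g w.
Proof.
move=> c0 vw; have [d [P [Q [fP fQ Qw gE]]]] := regP g w.
rewrite !gE ?vw ?(form_scale _ _ fP) ?(form_scale _ _ fQ) ?mulf_neq0 ?expf_neq0 //.
by field; rewrite Qw expf_neq0.
Qed.
End RegTheory.

Section RationalCone.
Context (k : closedFieldType) (E : lmodType k) (D : set E).
Variables (h : k -> E) (tau : E -> k) (W : {poly k}).
Hypothesis h_poly : forall l : {scalar E}, exists p : {poly k}, forall a, l (h a) = p.[a].
Hypothesis W0 : W != 0.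
Hypothesis hD : forall a, W.[a] != 0 -> D (h a).
Hypothesis tauP : forall e, D e ->
  W.[tau e] != 0 /\ exists2 c, c != 0 & e = c *: h (tau e).

(** The cone [D] is swept out by the lines through the points [h a] of a rational
    curve with coordinate [tau], so regular functions on it are the elements of
    [k[tau]] localised at [W]. *)
Lemma reg_fraction (g : reg D) : exists N n, forall v : D,
  g v = N.[tau (val v)] / W.[tau (val v)] ^+ n.
Proof.
pose pt a (Wa : W.[a] != 0) : D := exist _ (h a) (mem_set (hD Wa)).
pose g' a := if pselect (W.[a] != 0) is left Wa then g (pt a Wa) else 0.
have g'E a (Wa : W.[a] != 0) : g' a = g (pt a Wa).
  by rewrite /g'; case: pselect => // Wa'; congr (g _); exact: val_inj.
have [|N [n gE]] := @local_fraction k W g' W0.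
  move=> a Wa; have [d [P [Q [fP fQ Qa ge]]]] := regP g (pt a Wa).
  have [P' PE] := form_horner h_poly fP; have [Q' QE] := form_horner h_poly fQ.
  exists P', Q'; rewrite -QE; split=> // b Wb.
  by rewrite -QE -PE => Qb; rewrite g'E ge.
exists N, n => v.
have [Wv [c c0 vE]] := tauP (set_mem (valP v)).
by rewrite -gE // g'E; apply: reg_scale c0 _.
Qed.
End RationalCone.

(** * Normal form of a smooth conic *)

(** A basis [fe] of [E], with dual basis [fl], in which [xi] is the conic
    [2 fkappa (l0 l2 - l1^2)]. By [fx0] and [fx1] the points at infinity and at the origin
    of the parametrisation lie over the points [x0 = 0] and [x1 = 0] of [X], so that [l1 / l0] and
    [l1 / l2] are regular on the charts [x0 != 0] and [x1 != 0]. *)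
Record frame (k : fieldType) (q : algebraic_quadruple k) (x0 x1 : {scalar aqV q}) := Frame {
  fe : 'I_3 -> aqE q;
  fl : 'I_3 -> {scalar aqE q};
  fkappa : k;
  fkappa0 : fkappa != 0;
  fl_fe : forall i j, fl i (fe j) = (i == j)%:R;
  fe_expand : forall e, e = \sum_i fl i e *: fe i;
  fxi : forall i j : 'I_3, aqxi q (aqphi q (sprod (fe i) (fe j))) =
    if (i + j == 2)%N then (if i == 1 :> nat then - (fkappa *+ 2) else fkappa) else 0;
  fx0 : x0 (gmap (fe ord_max)) = 0;
  fx1 : x1 (gmap (fe ord0)) = 0;
  fV_inj : forall v v', x0 v = x0 v' -> x1 v = x1 v' -> aqxi q v = aqxi q v' -> v = v';
  fV_surj : forall a b c, exists v, [/\ x0 v = a, x1 v = b & aqxi q v = c] }.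

(** Exchanging [l0] and [l2] exchanges the charts of [X]; this reduces the second chart to
    the first one. *)
Lemma frame_swap (k : fieldType) (q : algebraic_quadruple k) (x0 x1 : {scalar aqV q}) :
  frame x0 x1 -> frame x1 x0.
Proof.
case=> e l kappa kappa0 le eE xie x0e x1e Vi Vs.
exists (fun i => e (rev_ord i)) (fun i => l (rev_ord i)) kappa => //.
- by move=> i j; rewrite le (inj_eq rev_ord_inj).
- by move=> x; rewrite [LHS]eE (reindex_inj rev_ord_inj).
- move=> i j; rewrite xie /=.
  by case: i j => [[|[|[|//]]] ?] [[|[|[|//]]] ?].
- by rewrite [rev_ord _](_ : _ = ord0) //; apply: val_inj.
- by rewrite [rev_ord _](_ : _ = ord_max) //; apply: val_inj.
- by move=> v v' *; apply: Vi.
- by move=> a b c; have [v [? ? ?]] := Vs b a c; exists v.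
Defined.

Lemma fe_swap (k : fieldType) (q : algebraic_quadruple k) (x0 x1 : {scalar aqV q})
  (fr : frame x0 x1) i : fe (frame_swap fr) i = fe fr (rev_ord i).
Proof. by case: fr. Qed.

Lemma fl_swap (k : fieldType) (q : algebraic_quadruple k) (x0 x1 : {scalar aqV q})
  (fr : frame x0 x1) i : fl (frame_swap fr) i = fl fr (rev_ord i).
Proof. by case: fr. Qed.

Section NetInFrame.
Context (k : closedFieldType) (q : algebraic_quadruple k) (x0 x1 : {scalar aqV q}).
Variable fr : frame x0 x1.
Hypothesis char_neq2 : 2%N \notin [pchar k].
Implicit Types x : {scalar aqV q}.

Local Notation e_ := (fe fr).
Local Notation l_ := (fl fr).

Definition netmx x (i j : 'I_3) : k := x (aqphi q (sprod (e_ i) (e_ j))).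

Lemma netmx_sym x i j : netmx x i j = netmx x j i.
Proof. by rewrite /netmx sprodC. Qed.

Lemma netmxE x e e' :
  x (aqphi q (sprod e e')) = \sum_i \sum_j netmx x i j * (l_ i e * l_ j e').
Proof.
rewrite {1}(fe_expand fr e) sprod_suml linear_sum linear_sum; apply: eq_bigr => i _.
rewrite {1}(fe_expand fr e') sprodC sprod_suml linear_sum linear_sum; apply: eq_bigr => j _.
by rewrite sprodZl sprodZr !linearZ /= /netmx sprodC; ring.
Qed.

(** The conic of [x] restricted to the parametrised conic of [xi]. *)
Definition netpoly x : {poly k} := \sum_(i < 3) \sum_(j < 3) (netmx x i j)%:P * 'X^(i + j).

Definition conic_pt (s : k) : aqE q := \sum_(i < 3) s ^+ i *: e_ i.

Lemma l_sum (c : 'I_3 -> k) i : l_ i (\sum_j c j *: e_ j) = c i.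
Proof.
rewrite linear_sum (bigD1 i) //= big1 ?addr0 => [|j ji].
  by rewrite linearZ /= fl_fe eqxx mulr1.
by rewrite linearZ /= fl_fe eq_sym (negPf ji) mulr0.
Qed.

Lemma l_conic_pt i s : l_ i (conic_pt s) = s ^+ i.
Proof. exact: (l_sum (fun i => s ^+ i)). Qed.

Lemma netpolyE x s : x (gmap (conic_pt s)) = (netpoly x).[s].
Proof.
rewrite /gmap netmxE horner_sum; apply: eq_bigr => i _.
rewrite horner_sum; apply: eq_bigr => j _.
by rewrite hornerM hornerC hornerXn !l_conic_pt exprD.
Qed.

Lemma netpoly_sum (S : comPzRingType) (c : {rmorphism k -> S}) x (r : nat -> S) :
  \sum_(i < 3) \sum_(j < 3) r (i + j)%N * c (netmx x i j) =
  \sum_(d < 5) c (netpoly x)`_d * r d.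
Proof.
have cE (d : nat) : (netpoly x)`_d = \sum_(i < 3) \sum_(j < 3) netmx x i j * (d == i + j)%N%:R.
  rewrite coef_sum; apply: eq_bigr => i _; rewrite coef_sum; apply: eq_bigr => j _.
  by rewrite coefCM coefXn.
under [RHS]eq_bigr => d _ do rewrite cE rmorph_sum mulr_suml.
rewrite [RHS]exchange_big; apply: eq_bigr => i _ /=.
under [RHS]eq_bigr => d _ do rewrite rmorph_sum mulr_suml.
rewrite [RHS]exchange_big; apply: eq_bigr => j _ /=.
have ij : (i + j < 5)%N by rewrite (@leq_ltn_trans (2 + 2)) // leq_add // -ltnS.
rewrite (bigD1 (Ordinal ij)) //= eqxx mulr1 big1 ?addr0 => [|d]; first exact: mulrC.
by rewrite -val_eqE /= => /negPf ->; rewrite mulr0 rmorph0 mul0r.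
Qed.

Lemma netpoly_size x : (size (netpoly x) <= 5)%N.
Proof.
rewrite /netpoly; apply: (leq_trans (size_sum _ _ _)); apply/bigmax_leqP => i _.
apply: (leq_trans (size_sum _ _ _)); apply/bigmax_leqP => j _.
rewrite mul_polyC; apply: (leq_trans (size_scale_leq _ _)).
by rewrite size_polyXn ltnS (@leq_trans (2 + 2)) // leq_add // -ltnS.
Qed.

Lemma netpoly_ends x :
  (netpoly x)`_0 = x (gmap (e_ ord0)) /\ (netpoly x)`_4 = x (gmap (e_ ord_max)).
Proof.
have := netpoly_sum idfun x (fun d => (d == 0%N)%:R).
have := netpoly_sum idfun x (fun d => (d == 4%N)%:R).
rewrite !big_ord_recl !big_ord0 /= /bump /= !(mul0r, mulr0, mul1r, mulr1, add0r, addr0).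
move=> <- <-; split=> //; rewrite /netmx /gmap.
by rewrite (_ : lift ord0 (lift ord0 ord0) = ord_max) //; apply: val_inj.
Qed.

Lemma xi_conic_pt s : aqxi q (gmap (conic_pt s)) = 0.
Proof.
rewrite /gmap netmxE !big_ord_recl !big_ord0 /netmx !fxi /= !l_conic_pt /bump /=.
by rewrite !mul0r !(add0r, addr0); ring.
Qed.

Lemma netpoly_xi : netpoly (aqxi q) = 0.
Proof.
apply: (poly_eq0_on_open (oner_neq0 _)) => s _.
by rewrite -netpolyE xi_conic_pt.
Qed.

Lemma gmap_neq0 e : e != 0 -> aqxi q (gmap e) = 0 -> x0 (gmap e) = 0 ->
  x1 (gmap e) != 0.
Proof.
move=> e0 xie x0e; apply/eqP => x1e.
have /eqP := aqphi_bpf e0; apply.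
by apply: (fV_inj fr); rewrite !linear0.
Qed.

Lemma e_neq0 i : e_ i != 0.
Proof.
apply/eqP => ei; have := fl_fe fr i i; rewrite ei linear0 eqxx => /esym/eqP.
by rewrite oner_eq0.
Qed.

Lemma xi_e_end : aqxi q (gmap (e_ ord_max)) = 0 /\ aqxi q (gmap (e_ ord0)) = 0.
Proof. by rewrite /gmap !fxi. Qed.

Lemma netpoly1_lead : (netpoly x1)`_4 != 0.
Proof.
rewrite (netpoly_ends x1).2 gmap_neq0 ?e_neq0 ?fx0 //; exact: xi_e_end.1.
Qed.

Lemma netpoly1_size : size (netpoly x1) = 5.
Proof.
apply/eqP; rewrite eqn_leq netpoly_size ltnNge.
by apply/leq_sizeP => /(_ 4%N (leqnn _)) /eqP; rewrite (negPf netpoly1_lead).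
Qed.

Lemma netpoly_coprime : coprimep (netpoly x0) (netpoly x1).
Proof.
rewrite coprimep_def; apply/eqP/eqP/negPn/negP => /closed_rootP[s].
rewrite root_gcd => /andP[/rootP p0s /rootP p1s].
have : conic_pt s != 0.
  apply/eqP => pts; have := l_conic_pt ord0 s; rewrite pts linear0 => /esym/eqP.
  by rewrite expr0 oner_eq0.
by move/gmap_neq0; rewrite xi_conic_pt !netpolyE p0s p1s eqxx => /(_ erefl erefl).
Qed.

Lemma netpoly0_neq0 : netpoly x0 != 0.
Proof.
apply/eqP => p00; have := netpoly_coprime; rewrite p00 coprime0p -size_poly_eq1.
by rewrite netpoly1_size.
Qed.

Lemma Ycone_l e : Ycone e -> l_ ord0 e * l_ ord_max e = l_ (lift ord0 ord0) e ^+ 2.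
Proof.
rewrite /Ycone /= /conic netmxE !big_ord_recl !big_ord0 /netmx !fxi /= /bump /=.
rewrite !mul0r !(add0r, addr0) (_ : lift ord0 (lift ord0 ord0) = ord_max); last exact: val_inj.
set a := l_ ord0 e; set c := l_ ord_max e; set b := l_ (lift ord0 ord0) e => h.
have two0 : 2%:R != 0 :> k.
  by apply: contra char_neq2 => two0; rewrite inE.
have : (fkappa fr * 2%:R) * (a * c - b ^+ 2) = 0 by rewrite -h; ring.
move/eqP; rewrite !mulf_eq0 (negPf (fkappa0 fr)) (negPf two0) /= subr_eq0.
by move/eqP.
Qed.

Lemma Ycone_l0 e : Ycone e -> x0 (gmap e) != 0 -> l_ ord0 e != 0.
Proof.
move=> Ye; apply: contraNneq => l0.
have l1 : l_ (lift ord0 ord0) e = 0.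
  by apply/eqP; rewrite -sqrf_eq0 -(Ycone_l Ye) l0 mul0r.
have eE : e = l_ ord_max e *: e_ ord_max.
  rewrite {1}(fe_expand fr e) !big_ord_recl big_ord0 l0 l1 !scale0r !add0r addr0.
  by rewrite (_ : lift ord0 (lift ord0 ord0) = ord_max) //; apply: val_inj.
have fxe := fx0 fr; rewrite /gmap in fxe.
by move: (l_ ord_max e) eE => c ->; rewrite /gmap sprodZl sprodZr !linearZ /= fxe !mulr0.
Qed.

(** The inverse of the parametrisation [conic_pt], as a rational function. *)
Definition slope (e : aqE q) : k := l_ (lift ord0 ord0) e / l_ ord0 e.

Lemma Ycone_param e : Ycone e -> x0 (gmap e) != 0 ->
  e = l_ ord0 e *: conic_pt (slope e).
Proof.
move=> Ye x0e; have l0 := Ycone_l0 Ye x0e; have l02 := Ycone_l Ye.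
rewrite {1}(fe_expand fr e) /conic_pt scaler_sumr !big_ord_recl !big_ord0.
rewrite (_ : lift ord0 (lift ord0 ord0) = ord_max); last exact: val_inj.
rewrite !scalerA /slope /= /bump /= expr0 mulr1 expr1.
congr (_ + (_ *: _ + (_ *: _ + _))); first by field.
by rewrite expr_div_n -l02; field.
Qed.

End NetInFrame.

(** * Coordinate rings of the charts *)

Section ConicChart.
Context (k : closedFieldType) (q : algebraic_quadruple k) (x0 x1 : {scalar aqV q}).
Variable fr : frame x0 x1.
Hypothesis char_neq2 : 2%N \notin [pchar k].

Local Notation p0 := (netpoly fr x0).
Local Notation p1 := (netpoly fr x1).
Local Notation ratio v := (x1 v / x0 v).

(** In the coordinate [x1 / x0] the open set [U] of [X] is the locus [om != 0], and [W]
    is an equation in the coordinate [s] for the complement of its inverse image in [Y]. *)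
Variables (U : set (aqV q)) (om W : {poly k}) (n : nat).
Hypothesis UE : forall v, Xcone v -> (U v <-> x0 v != 0 /\ om.[ratio v] != 0).
Hypothesis om0 : om != 0.
Hypothesis W0 : W != 0.
Hypothesis Wp0 : forall s, W.[s] != 0 -> p0.[s] != 0.
Hypothesis WE : forall s, p0.[s] != 0 -> W.[s] = p0.[s] ^+ n * om.[p1.[s] / p0.[s]].

Lemma Xopen_x0 (v : Xopen U) : x0 (val v) != 0.
Proof. by case: v => v /= /set_mem[/UE Uv /Uv[]]. Qed.

Lemma Xopen_om (v : Xopen U) : om.[ratio (val v)] != 0.
Proof. by case: v => v /= /set_mem[/UE Uv /Uv[]]. Qed.

Lemma gmap_scale c (e : aqE q) : gmap (c *: e) = c ^+ 2 *: gmap e.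
Proof. by rewrite /gmap sprodZl sprodZr scalerA linearZ. Qed.

Lemma Yopen_slope (e : aqE q) : Yopen U e ->
  [/\ W.[slope fr e] != 0,
      exists2 c, c != 0 & e = c *: conic_pt fr (slope fr e)
    & ratio (gmap e) = p1.[slope fr e] / p0.[slope fr e]].
Proof.
move=> [Ye Ue]; have [x0e ome] : x0 (gmap e) != 0 /\ om.[ratio (gmap e)] != 0.
  exact: (UE _).1 Ue.
have c0 := Ycone_l0 fr char_neq2 Ye x0e; have eE := Ycone_param fr char_neq2 Ye x0e.
have xE (x : {scalar aqV q}) : x (gmap e) = fl fr ord0 e ^+ 2 * (netpoly fr x).[slope fr e].
  by rewrite {1}eE gmap_scale linearZ /= netpolyE.
have p0e : p0.[slope fr e] != 0.
  by apply: contraNneq x0e => p0e; rewrite xE p0e mulr0.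
have rE : ratio (gmap e) = p1.[slope fr e] / p0.[slope fr e].
  by rewrite !xE; field; rewrite p0e c0.
split=> //; last by exists (fl fr ord0 e).
by rewrite WE // mulf_neq0 ?expf_neq0 // -rE.
Qed.

Lemma Yopen_conic_pt s : W.[s] != 0 -> Yopen U (conic_pt fr s).
Proof.
move=> Ws; have p0s := Wp0 Ws; split; first exact: xi_conic_pt.
apply/UE; first exact: xi_conic_pt.
rewrite /= !netpolyE; split=> //.
by move: Ws; rewrite WE // mulf_eq0 negb_or => /andP[].
Qed.

Lemma Xreg_fraction (g : reg (Xopen U)) : exists N d, forall v : Xopen U,
  g v = N.[ratio (val v)] / om.[ratio (val v)] ^+ d.
Proof.
have [v0 [v00 v01 v02]] := fV_surj fr 1 0 0.
have [v1 [v10 v11 v12]] := fV_surj fr 0 1 0.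
have x0h a : x0 (v0 + a *: v1) = 1 by rewrite linearD linearZ /= v00 v10 mulr0 addr0.
have x1h a : x1 (v0 + a *: v1) = a by rewrite linearD linearZ /= v01 v11 mulr1 add0r.
have xih a : aqxi q (v0 + a *: v1) = 0 by rewrite linearD linearZ /= v02 v12 mulr0 addr0.
apply: (@reg_fraction k (aqV q) (Xopen U) (fun a => v0 + a *: v1)
  (fun v => ratio v) om) => //.
- move=> l; exists ((l v0)%:P + l v1 *: 'X) => a.
  by rewrite linearD linearZ /= !hornerE; ring.
- move=> a oma; split; first exact: xih.
  by apply/UE; rewrite ?x0h ?x1h ?divr1 ?oner_neq0 //; exact: xih.
move=> v [Xv /UE[//|x0v omv]]; split=> //; exists (x0 v) => //.
apply: (fV_inj fr); rewrite linearZ /= ?x0h ?x1h ?xih ?mulr0 ?mulr1 //.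
by field.
Qed.

Lemma Yreg_fraction (g : reg (Yopen U)) : exists N d, forall v : Yopen U,
  g v = N.[slope fr (val v)] / W.[slope fr (val v)] ^+ d.
Proof.
apply: (@reg_fraction k (aqE q) (Yopen U) (conic_pt fr) (slope fr) W) => //.
- move=> l; exists (\sum_(i < 3) l (fe fr i) *: 'X^i) => a.
  rewrite linear_sum horner_sum; apply: eq_bigr => i _.
  by rewrite linearZ /= hornerZ hornerXn mulrC.
- exact: Yopen_conic_pt.
- by move=> e /Yopen_slope[].
Qed.

Lemma Xcoord_regular :
  (fun v : Xopen U => ratio (val v)) \in @regular _ _ (Xopen U).
Proof.
apply/asboolP => p; exists 1, x1, x0; split=> //; do ?exact: form_scalar.
exact: Xopen_x0.
Qed.
Definition Xcoord : reg (Xopen U) := Reg Xcoord_regular.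

Lemma Ycoord_regular :
  (fun v : Yopen U => slope fr (val v)) \in @regular _ _ (Yopen U).
Proof.
apply/asboolP => p; exists 1, (fl fr (lift ord0 ord0)), (fl fr ord0).
split=> //; do ?exact: form_scalar.
case: p => p /= /set_mem[Yp Up]; apply: (Ycone_l0 fr char_neq2 Yp).
by have [] := (UE Yp).1 Up.
Qed.
Definition Ycoord : reg (Yopen U) := Reg Ycoord_regular.

Local Notation rho := (fsharp U).

Lemma fsharpE (a : reg (Xopen U)) (v : Yopen U) w :
  val w = gmap (val v) -> rho a v = a w.
Proof. by move=> wv; congr (reg_fun a _); exact: val_inj. Qed.

Lemma fsharp_const c : rho (reg_const _ c) = reg_const _ c.
Proof. exact: reg_eq. Qed.

Lemma fsharp_Xcoord (v : Yopen U) :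
  rho Xcoord v = p1.[slope fr (val v)] / p0.[slope fr (val v)].
Proof. by have [_ _ <-] := Yopen_slope (set_mem (valP v)). Qed.

Definition netcoef (d : nat) : reg (Xopen U) :=
  reg_const _ p1`_d - Xcoord * reg_const _ p0`_d.

Lemma fsharp_netcoef d (v : Yopen U) : rho (netcoef d) v =
  p1`_d - p1.[slope fr (val v)] / p0.[slope fr (val v)] * p0`_d.
Proof. by rewrite -fsharp_Xcoord. Qed.

Lemma netcoef_lead : netcoef 4 = reg_const _ p1`_4.
Proof.
rewrite /netcoef (netpoly_ends fr x0).2 fx0 [reg_const _ 0]rmorph0 mulr0.
exact: subr0.
Qed.

Lemma netcoef_rel :
  rho (netcoef 0) + rho (netcoef 1) * Ycoord + rho (netcoef 2) * Ycoord ^+ 2 +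
  rho (netcoef 3) * Ycoord ^+ 3 + rho (netcoef 4) * Ycoord ^+ 4 = 0.
Proof.
apply: reg_eq => v; have [Wv _ _] := Yopen_slope (set_mem (valP v)).
have p0v := Wp0 Wv.
rewrite !regD !(regM (rho _)) !regX reg0 !fsharp_netcoef -[Ycoord v]/(slope fr (val v)).
set s := slope fr (val v).
have pE (p : {poly k}) : (size p <= 5)%N -> p.[s] =
    p`_0 + p`_1 * s + p`_2 * s ^+ 2 + p`_3 * s ^+ 3 + p`_4 * s ^+ 4.
  move=> p5; rewrite (horner_coef_wide _ p5) !big_ord_recl big_ord0 /bump /= addr0.
  by rewrite expr0 mulr1 !addrA.
transitivity (p1.[s] - p1.[s] / p0.[s] * p0.[s]); last by rewrite divfK ?subrr.
move: (p1.[s] / p0.[s]) => c.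
rewrite (pE p1 (netpoly_size _ _)) (pE p0 (netpoly_size _ _)); ring.
Qed.

Variable oinv : reg (Xopen U).
Hypothesis oinvE : forall v : Xopen U, oinv v = om.[ratio (val v)]^-1.

(** A regular function is [N(s) / W(s)^d], and the combinations of [1, s, s^2, s^3] are
    stable by [s], as the leading coefficient of the quartic relation is invertible. They
    are also stable by [1 / W]: a Bezout relation [u p0 + u' p1 = 1] gives
    [1 / p0 = u(s) + u'(s) x], and [1 / om] is a function on [U]. *)
Lemma Ycoord_gen (a : reg (Yopen U)) :
  exists c : 'I_4 -> reg (Xopen U), a = \sum_(i < 4) rho (c i) * Ycoord ^+ i.
Proof.
pose M (a : reg (Yopen U)) :=
  exists c : 'I_4 -> reg (Xopen U), a = \sum_(i < 4) rho (c i) * Ycoord ^+ i.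
rewrite -/(M a).
pose T b := forall a, M a -> M (b * a).
have MD a1 a2 : M a1 -> M a2 -> M (a1 + a2).
  move=> [c1 ->] [c2 ->]; exists (fun i => c1 i + c2 i).
  by rewrite -big_split; apply: eq_bigr => i _; rewrite rmorphD mulrDl.
have Tr r : T (rho r).
  move=> b [c ->]; exists (fun i => r * c i); rewrite mulr_sumr.
  by apply: eq_bigr => i _; rewrite rmorphM mulrA.
have TD b1 b2 : T b1 -> T b2 -> T (b1 + b2).
  by move=> T1 T2 b Mb; rewrite mulrDl; apply: MD; [exact: T1 | exact: T2].
have TM b1 b2 : T b1 -> T b2 -> T (b1 * b2).
  by move=> T1 T2 b Mb; rewrite -mulrA; apply/T1/T2.
have MX i : (i < 4)%N -> M (Ycoord ^+ i).
  move=> i4; exists (fun j => (j == Ordinal i4)%:R).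
  rewrite (eq_bigr (fun j => if j == Ordinal i4 then Ycoord ^+ i else 0)).
    by rewrite -big_mkcond big_pred1_eq.
  by move=> j _; case: eqP => [->|_]; rewrite ?rmorph1 ?mul1r ?rmorph0 ?mul0r.
have MX4 : M (Ycoord ^+ 4).
  pose w : reg (Xopen U) := reg_const _ (p1`_4)^-1.
  have w1 : w * netcoef 4 = 1.
    by rewrite netcoef_lead -rmorphM mulVf ?rmorph1 //; exact: netpoly1_lead.
  have -> : Ycoord ^+ 4 = rho (- w) * (rho (netcoef 0) * Ycoord ^+ 0 +
      rho (netcoef 1) * Ycoord ^+ 1 + rho (netcoef 2) * Ycoord ^+ 2 +
      rho (netcoef 3) * Ycoord ^+ 3).
    apply/eqP; rewrite rmorphN mulNr -addr_eq0; apply/eqP.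
    rewrite -[X in X + _ = _]mul1r -[X in X * _](rmorph1 rho) -w1 rmorphM.
    apply: etrans (mulr0 (rho w)); rewrite -[in RHS]netcoef_rel; ring.
  by apply: (Tr); do ?apply: (MD); apply: (Tr); exact: MX.
have Ts : T Ycoord.
  move=> b [c ->]; rewrite mulr_sumr; apply: big_ind => //.
    by exists (fun _ => 0); rewrite big1 // => i _; rewrite rmorph0 mul0r.
  move=> i _; rewrite mulrCA -exprS; apply: Tr.
  by have := ltn_ord i; rewrite leq_eqVlt => /orP[/eqP ->|/MX].
have Tc c : T (reg_const _ c) by rewrite -fsharp_const; exact: Tr.
have T1 : T 1 by rewrite -(rmorph1 rho); exact: Tr.
have TX b d : T b -> T (b ^+ d).
  by move=> Tb; elim: d => [|d IHd]; rewrite ?expr0 // exprS; exact: TM.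
have Tp (p : {poly k}) (b : reg (Yopen U)) :
    (forall v : Yopen U, b v = p.[slope fr (val v)]) -> T b.
  move=> bp; suff -> : b = \sum_(i < size p) reg_const _ p`_i * Ycoord ^+ i.
    apply: big_ind => [|b1 b2|i _]; [|exact: TD|exact/TM/TX].
    by rewrite -(rmorph0 rho); exact: Tr.
  apply: reg_eq => v; rewrite bp horner_coef reg_sum; apply: eq_bigr => i _.
  by rewrite regM regX.
have preg (p : {poly k}) :
    exists b : reg (Yopen U), forall v : Yopen U, b v = p.[slope fr (val v)].
  exists (\sum_(i < size p) reg_const _ p`_i * Ycoord ^+ i) => v.
  by rewrite horner_coef reg_sum; apply: eq_bigr => i _; rewrite regM regX.
have [b0 Tb0 b0E] : exists2 b, T b & forall v : Yopen U, b v = p0.[slope fr (val v)]^-1.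
  have /Bezout_eq1_coprimepP[[u u'] /= uu'] := netpoly_coprime fr.
  have [bu buE] := preg u; have [bu' bu'E] := preg u'.
  exists (bu + bu' * rho Xcoord) => [|v].
    by apply: TD; [exact: Tp buE | apply: TM; [exact: Tp bu'E | exact: Tr]].
  have [Wv _ _] := Yopen_slope (set_mem (valP v)); have p0v := Wp0 Wv.
  rewrite regD regM buE bu'E fsharp_Xcoord.
  have := congr1 (horner^~ (slope fr (val v))) uu'.
  rewrite hornerD !hornerM hornerC => uu'v; apply: (mulIf p0v).
  by rewrite mulVf // -[RHS]uu'v; field.
have [N [d aE]] := Yreg_fraction a.
have [bN bNE] := preg N.
have M1 : M 1 by rewrite -(expr0 Ycoord); exact: MX.
have -> : a = bN * (b0 ^+ n * rho oinv) ^+ d * 1.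
  apply: reg_eq => v; have [Wv _ rE] := Yopen_slope (set_mem (valP v)).
  have p0v := Wp0 Wv.
  rewrite aE mulr1 regM bNE regX regM regX b0E; congr (_ * _).
  rewrite -exprVn; congr (_ ^+ _).
  by rewrite -[rho oinv v]/(oinv _) oinvE /= rE WE // invfM exprVn.
apply: (TM) M1; first exact: Tp bNE.
by apply/TX/TM; [exact: TX | exact: Tr].
Qed.

Lemma Ycoord_free (c : 'I_4 -> reg (Xopen U)) :
  \sum_(i < 4) rho (c i) * Ycoord ^+ i = 0 -> forall i, c i = 0.
Proof.
move=> c0.
have /choice[N' NE] : forall i, exists Nd : {poly k} * nat, forall v : Xopen U,
    c i v = Nd.1.[ratio (val v)] / om.[ratio (val v)] ^+ Nd.2.
  by move=> i; have [N [d ?]] := Xreg_fraction (c i); exists (N, d).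
pose m := (\sum_i (N' i).2)%N.
pose N i := (N' i).1 * om ^+ (m - (N' i).2).
have cE i (v : Xopen U) : c i v = (N i).[ratio (val v)] / om.[ratio (val v)] ^+ m.
  have omv := Xopen_om v.
  have dm : ((N' i).2 <= m)%N by rewrite /m (bigD1 i) //= leq_addr.
  rewrite NE hornerM horner_exp -[in X in _ = _ / X](subnK dm) exprD.
  by field; rewrite !expf_neq0.
suff N0 : forall i, N i = 0.
  by move=> i; apply: reg_eq => v; rewrite cE N0 horner0 mul0r.
apply: (fraction_powers_free (netpoly_coprime fr) (netpoly1_size fr) W0 Wp0).
move=> s Ws.
pose y : Yopen U := exist (fun e => e \in Yopen U) _ (mem_set (Yopen_conic_pt Ws)).
have ys : slope fr (val y) = s.
  by rewrite /slope /= !l_conic_pt expr0 divr1 expr1.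
have [Wy _ rE] := Yopen_slope (set_mem (valP y)).
pose x : Xopen U := exist (fun v => v \in Xopen U) _
  (mem_set (gmap_open (Yopen_conic_pt Ws))).
have xE : ratio (val x) = p1.[s] / p0.[s] by rewrite -[in RHS]ys -rE.
have om_x := Xopen_om x; have omm : om.[ratio (val x)] ^+ m != 0 by rewrite expf_neq0.
have := congr1 (fun f : reg (Yopen U) => f y) c0.
rewrite reg_sum reg0 => h; apply: (mulIf (invr_neq0 omm)).
rewrite mul0r mulr_suml -[RHS]h; apply: eq_bigr => i _.
rewrite regM regX (@fsharpE _ _ x) // cE -xE -[Ycoord y]/(slope fr (val y)) ys.
by field.
Qed.

Lemma Ycoord_basis : is_basis rho (fun i : 'I_4 => Ycoord ^+ i).
Proof.
move=> a; have [c aE] := Ycoord_gen a; exists c; split=> // c' aE'.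
apply/funext => i; apply/eqP; rewrite -subr_eq0; apply/eqP.
apply: (@Ycoord_free (fun i => c i - c' i)).
apply: etrans (subrr a); rewrite {1}aE aE' -sumrB; apply: eq_bigr => j _.
by rewrite rmorphB mulrBl.
Qed.

End ConicChart.

(** * Existence of the normal form *)

Section FrameExists.
Context (k : closedFieldType) (q : algebraic_quadruple k).
Hypothesis char_neq2 : 2%N \notin [pchar k].

Local Notation E := (aqE q).
Local Notation B e e' := (aqxi q (aqphi q (sprod e e'))).

Hypothesis B_nondeg : forall e : E, e != 0 -> exists e' : E, B e e' != 0.

Lemma two_neq0 : 2%:R != 0 :> k.
Proof. by apply: contra char_neq2 => two0; rewrite inE. Qed.

Lemma sprod_form_D (x : {scalar aqV q}) e e' e'' :
  x (aqphi q (sprod (e + e') e'')) =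
  x (aqphi q (sprod e e'')) + x (aqphi q (sprod e' e'')).
Proof. by rewrite sprodDl !linearD. Qed.

Lemma sprod_form_Z (x : {scalar aqV q}) a e e' :
  x (aqphi q (sprod (a *: e) e')) = a * x (aqphi q (sprod e e')).
Proof. by rewrite sprodZl !linearZ. Qed.

Lemma sprod_form_sym (x : {scalar aqV q}) e e' :
  x (aqphi q (sprod e e')) = x (aqphi q (sprod e' e)).
Proof. by rewrite sprodC. Qed.

Lemma closed_sqrt (a : k) : exists c, c ^+ 2 = a.
Proof.
have : size ('X^2 - a%:P) != 1 by rewrite size_XnsubC.
case/closed_rootP => c; rewrite /root !hornerE subr_eq0 => /eqP <-.
by exists c.
Qed.

Lemma free3_expand (X : 3.-tuple E) e : free X -> e = \sum_i coord X i e *: X`_i.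
Proof.
move=> fX; apply: coord_span.
suff /eqP -> : (<<X>>%VS == fullv) by exact: memvf.
rewrite eqEdim subvf /= (aqE_dim q).
by rewrite (eqP (fX : \dim <<X>> == size X)) size_tuple.
Qed.

Lemma notin_span2 (e e' : E) : exists w, w \notin <<[:: e; e']>>%VS.
Proof.
apply: contrapT => h.
have : (fullv <= <<[:: e; e']>>)%VS.
  apply/subvP => v _; apply/negPn/negP => vn; apply: h; by exists v.
move/dimvS; rewrite (aqE_dim q) => /leq_trans/(_ (dim_span _)).
by [].
Qed.

Lemma indep_free (e e' : E) :
  (forall a b, a *: e + b *: e' = 0 -> a = 0 /\ b = 0) -> free [:: e; e'].
Proof.
move=> ind; apply/(@freeP _ _ 2 [tuple e; e']) => c.
rewrite !big_ord_recl big_ord0 addr0 /= => /ind[c0 c1].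
by case=> [[|[|//]]] i2; [rewrite -[RHS]c0|rewrite -[RHS]c1];
  congr (c _); apply: val_inj.
Qed.

(** If the pairing vanished, some combination of [e0] and [e2] would be orthogonal to a
    third basis vector as well, hence to all of [E]. *)
Lemma isotropic_pair (e0 e2 : E) :
  (forall a b, a *: e0 + b *: e2 = 0 -> a = 0 /\ b = 0) ->
  B e0 e0 = 0 -> B e2 e2 = 0 -> B e0 e2 != 0.
Proof.
move=> ind B00 B22; apply/eqP => B02.
have [w wn] := notin_span2 e0 e2.
have fX : free [tuple w; e0; e2] by rewrite /= free_cons wn indep_free.
have [u [u0 uw ue0 ue2]] : exists u, [/\ u != 0, B u w = 0, B u e0 = 0 & B u e2 = 0].
  have e00 : e0 != 0.
    apply/eqP => e00; have [] := ind 1 0; last by move/eqP; rewrite oner_eq0.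
    by rewrite e00 scaler0 scale0r addr0.
  have [e0w|e0w] := eqVneq (B e0 w) 0; first by exists e0.
  exists (B e2 w *: e0 + (- B e0 w) *: e2); split.
  - by apply/eqP => /ind[_ /eqP]; rewrite oppr_eq0 (negPf e0w).
  - by rewrite sprod_form_D !sprod_form_Z; ring.
  - by rewrite sprod_form_D !sprod_form_Z B00 (sprod_form_sym _ e2 e0) B02; ring.
  - by rewrite sprod_form_D !sprod_form_Z B22 B02; ring.
have [e' /eqP] := B_nondeg u0; apply.
rewrite (free3_expand e' fX) !big_ord_recl big_ord0 addr0 /= sprod_form_sym.
rewrite !sprod_form_D !sprod_form_Z !(sprod_form_sym _ _ u) uw ue0 ue2; ring.
Qed.

(** The vector [e1] spans the line orthogonal to [e0] and [e2]; it is scaled so that the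
    conic has equation [l0 l2 = l1^2] in the resulting basis. *)
Lemma hyperbolic_complete (e0 e2 : E) :
    B e0 e0 = 0 -> B e2 e2 = 0 -> B e0 e2 != 0 ->
  exists e1, [/\ free [tuple e0; e1; e2], B e0 e1 = 0, B e1 e2 = 0 &
    B e1 e1 = - (B e0 e2 *+ 2)].
Proof.
move=> B00 B22; set kap := B e0 e2 => kap0.
have B20 : B e2 e0 = kap by rewrite sprod_form_sym.
have [w wn] := notin_span2 e0 e2.
pose f1 := w + ((- (B w e2 / kap)) *: e0 + (- (B w e0 / kap)) *: e2).
have f10 : B f1 e0 = 0.
  by rewrite 2!sprod_form_D !sprod_form_Z B00 B20; field.
have f12 : B f1 e2 = 0.
  by rewrite 2!sprod_form_D !sprod_form_Z B22 -/kap; field.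
have indep a b c : a *: e0 + b *: f1 + c *: e2 = 0 -> [/\ a = 0, b *: f1 = 0 & c = 0].
  move=> abc.
  have a0 : a = 0.
    have := sprod0l e2; rewrite -abc => /(congr1 (aqxi q \o aqphi q)) /=.
    rewrite !linear0 2!sprod_form_D !sprod_form_Z B22 f12 -/kap !mulr0 !addr0.
    by move/eqP; rewrite mulf_eq0 (negPf kap0) orbF => /eqP.
  have c0 : c = 0.
    have := sprod0l e0; rewrite -abc => /(congr1 (aqxi q \o aqphi q)) /=.
    rewrite !linear0 2!sprod_form_D !sprod_form_Z B00 f10 B20 !mulr0 !add0r.
    by move/eqP; rewrite mulf_eq0 (negPf kap0) orbF => /eqP.
  by split=> //; move: abc; rewrite a0 c0 !scale0r add0r addr0.
have f1n0 : f1 != 0.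
  apply: contraNneq wn => /eqP; rewrite addr_eq0 => /eqP ->.
  by rewrite rpredN rpredD // rpredZ // memv_span // !inE eqxx ?orbT.
have freeX b : b != 0 -> free [tuple e0; b *: f1; e2].
  move=> b0; apply/freeP => c; rewrite !big_ord_recl big_ord0 addr0 addrA /= scalerA.
  move=> /indep[c0 c1 c2].
  have {}c1 : c (lift ord0 ord0) = 0.
    by move/eqP: c1; rewrite scaler_eq0 mulf_eq0 (negPf b0) (negPf f1n0) !orbF => /eqP.
  case=> [[|[|[|//]]]] i3; [rewrite -[RHS]c0|rewrite -[RHS]c1|rewrite -[RHS]c2];
    by congr (c _); apply: val_inj.
have f11 : B f1 f1 != 0.
  apply/eqP => f11; have [e' /eqP] := B_nondeg f1n0; apply.
  rewrite (free3_expand e' (freeX 1 (oner_neq0 k))) !big_ord_recl big_ord0 addr0 /=.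
  rewrite scale1r sprod_form_sym !sprod_form_D !sprod_form_Z.
  by rewrite !(sprod_form_sym _ _ f1) f11 f10 f12; ring.
have [c cE] := closed_sqrt (- (kap *+ 2) / B f1 f1).
have c0 : c != 0.
  rewrite -sqrf_eq0 cE mulf_neq0 ?invr_eq0 // oppr_eq0 -mulr_natr.
  by rewrite mulf_neq0 // two_neq0.
exists (c *: f1); split; first exact: freeX.
- by rewrite sprod_form_sym sprod_form_Z f10 mulr0.
- by rewrite sprod_form_Z f12 mulr0.
rewrite sprod_form_Z sprod_form_sym sprod_form_Z mulrA -expr2 cE.
by field.
Qed.

Lemma isotropic_exists : exists2 e : E, e != 0 & B e e = 0.
Proof.
have [a an] := notin_span2 0 0.
have a0 : a != 0 by apply: contraNneq an => ->; rewrite mem0v.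
have [b bn] := notin_span2 a a.
have ind s t : s *: a + t *: b = 0 -> t = 0.
  move=> st; apply/eqP/negPn/negP => t0; case/negP: bn.
  have -> : b = (- (s / t)) *: a.
    apply: (scalerI t0); rewrite scalerA mulrN mulrCA divff // mulr1 scaleNr.
    by apply/eqP; rewrite -addr_eq0 addrC st.
  by rewrite rpredZ // memv_span // inE eqxx.
have [Bbb|Bbb] := eqVneq (B b b) 0.
  by exists b => //; apply: contraNneq bn => ->; rewrite mem0v.
pose P : {poly k} := Poly [:: B a a; B a b *+ 2; B b b].
have PE t : P.[t] = B (a + t *: b) (a + t *: b).
  rewrite horner_Poly /= !sprod_form_D !(sprod_form_sym _ _ (a + t *: b)).
  rewrite !sprod_form_D !sprod_form_Z !(sprod_form_sym _ _ (t *: b)) !sprod_form_Z.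
  by rewrite (sprod_form_sym _ b a); ring.
have : size P != 1 by rewrite (@PolyK _ 0) /= ?Bbb.
case/closed_rootP => t /rootP; rewrite PE => Bt.
exists (a + t *: b) => //; apply/eqP => abt.
have t0 : t = 0 by apply: (ind 1); rewrite scale1r.
by case/eqP: a0; rewrite -[RHS]abt t0 scale0r addr0.
Qed.

(** The parametrisation [e0 + s e1 + s^2 e2] of [Y] turns the equation of [x] into a
    polynomial in [s] of degree 4, unless [x] already vanishes at [e2]. *)
Lemma conic_meets (x : {scalar aqV q}) :
  exists e : E, [/\ e != 0, B e e = 0 & x (aqphi q (sprod e e)) = 0].
Proof.
have [e0 e00 B00] := isotropic_exists.
have [w B0w] := B_nondeg e00.
(* The second isotropic vector of the hyperbolic plane spanned by [e0] and [w]. *)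
pose e2 := w + (- (B w w / (B e0 w *+ 2))) *: e0.
have Be02 : B e0 e2 = B e0 w.
  by rewrite sprod_form_sym sprod_form_D sprod_form_Z B00 mulr0 addr0 sprod_form_sym.
have B22 : B e2 e2 = 0.
  rewrite {1}/e2 sprod_form_D sprod_form_Z Be02 /e2 sprod_form_sym sprod_form_D.
  rewrite sprod_form_Z -mulr_natr; field.
  by rewrite B0w two_neq0.
have e20 : e2 != 0.
  by apply: contraNneq B0w => e20; rewrite -Be02 e20 sprod0r !linear0.
have B02 : B e0 e2 != 0 by rewrite Be02.
clearbody e2.
have [e1 [fX B01 B12 B11]] := hyperbolic_complete B00 B22 B02.
have [xe2|xe2] := eqVneq (x (aqphi q (sprod e2 e2))) 0; first by exists e2.
pose G e e' := x (aqphi q (sprod e e')).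
pose P : {poly k} := Poly [:: G e0 e0; G e0 e1 *+ 2; G e0 e2 *+ 2 + G e1 e1;
  G e1 e2 *+ 2; G e2 e2].
have ptE (y : {scalar aqV q}) (s : k) (H := fun e e' => y (aqphi q (sprod e e'))) :
    H (e0 + (s *: e1 + s ^+ 2 *: e2)) (e0 + (s *: e1 + s ^+ 2 *: e2)) =
    H e0 e0 + H e0 e1 *+ 2 * s + (H e0 e2 *+ 2 + H e1 e1) * s ^+ 2 +
    H e1 e2 *+ 2 * s ^+ 3 + H e2 e2 * s ^+ 4.
  rewrite /H !sprod_form_D !sprod_form_Z !(sprod_form_sym _ _ (e0 + _)).
  rewrite !sprod_form_D !sprod_form_Z.
  by rewrite (sprod_form_sym _ e1 e0) (sprod_form_sym _ e2 e0) (sprod_form_sym _ e2 e1); ring.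
have : size P != 1 by rewrite (@PolyK _ 0) /= ?xe2.
case/closed_rootP => s /rootP Ps.
exists (e0 + (s *: e1 + s ^+ 2 *: e2)); split.
- apply/eqP => pt0; have : B (e0 + (s *: e1 + s ^+ 2 *: e2)) e2 = 0.
    by rewrite pt0 sprod0l !linear0.
  rewrite !sprod_form_D !sprod_form_Z B22 B12 !mulr0 !addr0 => /eqP.
  by rewrite (negPf B02).
- by rewrite (ptE (aqxi q)) B00 B01 B11 B12 B22; ring.
by rewrite (ptE x) -[RHS]Ps horner_Poly /= /G; ring.
Qed.

End FrameExists.

Section CoordinatesOnTarget.
Context (k : closedFieldType) (q : algebraic_quadruple k) (x0 x1 : {scalar aqV q}).
Hypothesis x01 : coordinates_on_X x0 x1.

Lemma coordinates_inj v v' :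
  x0 v = x0 v' -> x1 v = x1 v' -> aqxi q v = aqxi q v' -> v = v'.
Proof.
move=> v0 v1 v2; apply/eqP; rewrite -subr_eq0; apply/eqP.
by apply: x01; rewrite /Xcone /= linearB /= ?v0 ?v1 ?v2 subrr.
Qed.

(** An injective linear map between spaces of dimension 3. *)
Lemma coordinates_surj a b c : exists v, [/\ x0 v = a, x1 v = b & aqxi q v = c].
Proof.
pose T v : 'rV[k]_3 := \row_i nth 0 [:: x0 v; x1 v; aqxi q v] i.
have Tlin : linear T.
  move=> t v w; apply/rowP => i; rewrite !mxE.
  by case: i => [[|[|[|//]]] ?] /=; rewrite linearP.
pose T' : {linear aqV q -> 'rV[k]_3} :=
  HB.pack T (GRing.isLinear.Build k (aqV q) 'rV[k]_3 *:%R T Tlin).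
pose f := linfun T'.
have fE v : f v = T v by rewrite lfunE.
have ker0 : lker f = 0%VS.
  apply/eqP/lker0P => v w; rewrite !fE => /rowP Tvw.
  apply: coordinates_inj.
  - by have := Tvw (inord 0); rewrite !mxE inordK.
  - by have := Tvw (inord 1); rewrite !mxE inordK.
  - by have := Tvw (inord 2); rewrite !mxE inordK.
have full : limg f = fullv.
  apply/eqP; rewrite eqEdim subvf /= limg_dim_eq ?ker0 ?capv0 //.
  by rewrite (aqV_dim q) dimvf /dim /= mul1n.
have /memv_imgP[v _ vE] : \row_i nth 0 [:: a; b; c] i \in limg f by rewrite full memvf.
exists v; move/rowP: vE => vE; split.
- by have := vE (inord 0); rewrite fE !mxE inordK.
- by have := vE (inord 1); rewrite fE !mxE inordK.
- by have := vE (inord 2); rewrite fE !mxE inordK.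
Qed.
End CoordinatesOnTarget.

(** The points [e0] and [e2] are chosen on the conics [x1] and [x0]. They are distinct: a
    common point would be a base point of the net. *)
Lemma frame_exists (k : closedFieldType) (q : algebraic_quadruple k)
    (x0 x1 : {scalar aqV q}) : 2%N \notin [pchar k] ->
  ~ discriminant_locus (aqxi q) -> coordinates_on_X x0 x1 -> inhabited (frame x0 x1).
Proof.
move=> char2 smooth x01.
have nondeg (e : aqE q) : e != 0 -> exists e', aqxi q (aqphi q (sprod e e')) != 0.
  move=> e0; apply: contrapT => h.
  have Be0 e' : aqxi q (aqphi q (sprod e e')) = 0.
    by apply/eqP/negPn/negP => Be; apply: h; exists e'.
  apply: smooth; split; first exact: aqxi_neq0.
  by exists e; split=> // [|e']; rewrite /conic /conic_diff Be0 ?mul0rn.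
have [e0 [e00 B00 x1e0]] := conic_meets char2 nondeg x1.
have [e2 [e20 B22 x0e2]] := conic_meets char2 nondeg x0.
have B02 : aqxi q (aqphi q (sprod e0 e2)) != 0.
  apply: (isotropic_pair nondeg) => // a b ab.
  have a0 : a = 0.
    apply/eqP/negPn/negP => a0; have /eqP := aqphi_bpf e00; apply.
    have e0E : e0 = (- (b / a)) *: e2.
      apply: (scalerI a0); rewrite scalerA mulrN mulrCA divff // mulr1 scaleNr.
      by apply/eqP; rewrite -addr_eq0 ab.
    apply: (coordinates_inj x01); rewrite linear0 //.
    by rewrite e0E !(sprod_form_Z, sprod_form_sym _ _ (_ *: _)) x0e2 !mulr0.
  split=> //; move/eqP: ab; rewrite a0 scale0r add0r scaler_eq0 (negPf e20) orbF.
  by move/eqP.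
have [e1 [fX B01 B12 B11]] := hyperbolic_complete char2 nondeg B00 B22 B02.
constructor.
set X := [tuple e0; e1; e2].
exists (fun i => X`_i) (fun i => coord X i) (aqxi q (aqphi q (sprod e0 e2))) => //.
- by move=> i j; rewrite -[LHS]/(coord X i X`_j) coord_free // eq_sym.
- by move=> e; exact: (free3_expand e fX).
- case=> [[|[|[|//]]] ?] [[|[|[|//]]] ?] //=; by rewrite sprodC.
- exact: coordinates_inj.
- exact: coordinates_surj.
Qed.

(** * The pencil of conics through a fibre *)

Section FrameOnChart.
Context (k : closedFieldType) (q : algebraic_quadruple k) (y0 y1 : {scalar aqV q}).
Variable fr : frame y0 y1.
Hypothesis char_neq2 : 2%N \notin [pchar k].
Context (R A : comPzRingType) (rho : {rmorphism R -> A}) (cst : {rmorphism k -> R}).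
Variables (X : R) (s : A).

(** The coefficients of the quartic equation [p1 - X p0] of the fibre over [X]. *)
Definition pencil_coef d : R := cst (netpoly fr y1)`_d - X * cst (netpoly fr y0)`_d.

Hypothesis sbasis : is_basis rho (fun i : 'I_4 => s ^+ i).
Hypothesis srel :
  rho (pencil_coef 0) + rho (pencil_coef 1) * s + rho (pencil_coef 2) * s ^+ 2 +
  rho (pencil_coef 3) * s ^+ 3 + rho (pencil_coef 4) * s ^+ 4 = 0.

Definition chart_w : R := cst ((netpoly fr y1)`_4)^-1.

Lemma chart_wF : chart_w * pencil_coef 4 = 1.
Proof.
rewrite /pencil_coef (netpoly_ends fr y0).2 fx0 rmorph0 mulr0 subr0 -rmorphM.
by rewrite mulVf ?rmorph1 // netpoly1_lead.
Qed.

Local Notation th := (theta sbasis chart_w).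

Definition xi_mx i j : R := cst (netmx fr (aqxi q) i j).
Definition pencil_mx i j : R := cst (netmx fr y1 i j) - X * cst (netmx fr y0 i j).

Lemma xi_mx_sym i j : xi_mx i j = xi_mx j i.
Proof. by rewrite /xi_mx netmx_sym. Qed.
Lemma pencil_mx_sym i j : pencil_mx i j = pencil_mx j i.
Proof. by rewrite /pencil_mx !(netmx_sym fr _ i j). Qed.

(** The conic of [xi] and the member [y1 - X y0] of the net vanish at [(1, s, s^2)], i.e. on
    the fibre; they span the pencil of conics through it. *)
Lemma xi_mx_rel : \sum_(i < 3) \sum_(j < 3) rho (xi_mx i j) * s ^+ (i + j) = 0.
Proof.
transitivity (\sum_(i < 3) \sum_(j < 3) s ^+ (i + j) * (rho \o cst) (netmx fr (aqxi q) i j)).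
  by do 2!apply: eq_bigr => ? _; rewrite mulrC.
rewrite (netpoly_sum fr (rho \o cst) (aqxi q) (fun d => s ^+ d)) netpoly_xi.
by rewrite big1 // => d _; rewrite coef0 rmorph0 mul0r.
Qed.

Lemma pencil_mx_sum (r : nat -> R) :
  \sum_(i < 3) \sum_(j < 3) r (i + j)%N * pencil_mx i j =
  r 0 * pencil_coef 0 + r 1 * pencil_coef 1 + r 2 * pencil_coef 2 +
  r 3 * pencil_coef 3 + r 4 * pencil_coef 4.
Proof.
transitivity (\sum_(i < 3) \sum_(j < 3) r (i + j)%N * cst (netmx fr y1 i j) -
    X * \sum_(i < 3) \sum_(j < 3) r (i + j)%N * cst (netmx fr y0 i j)).
  rewrite mulr_sumr -sumrB; apply: eq_bigr => i _.
  rewrite mulr_sumr -sumrB; apply: eq_bigr => j _.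
  by rewrite /pencil_mx; ring.
rewrite !netpoly_sum !big_ord_recr !big_ord0 /= /pencil_coef; ring.
Qed.

Lemma pencil_mx_rel : \sum_(i < 3) \sum_(j < 3) rho (pencil_mx i j) * s ^+ (i + j) = 0.
Proof.
transitivity (\sum_(i < 3) \sum_(j < 3) s ^+ (i + j) * (rho \o cst) (netmx fr y1 i j) -
    rho X * \sum_(i < 3) \sum_(j < 3) s ^+ (i + j) * (rho \o cst) (netmx fr y0 i j)).
  rewrite mulr_sumr -sumrB; apply: eq_bigr => i _.
  rewrite mulr_sumr -sumrB; apply: eq_bigr => j _.
  by rewrite /pencil_mx rmorphB rmorphM /=; ring.
rewrite !(netpoly_sum fr (rho \o cst) _ (fun d => s ^+ d)) !big_ord_recr !big_ord0 /=.
by rewrite -[RHS]srel /pencil_coef !rmorphB !rmorphM; ring.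
Qed.

Definition q_xi : {linear QQ rho -> R^o} := netform_QQ sbasis chart_w xi_mx_sym xi_mx_rel.
Definition q_pencil : {linear QQ rho -> R^o} :=
  netform_QQ sbasis chart_w pencil_mx_sym pencil_mx_rel.

Lemma q_xiE x y : q_xi (QQpr (sprod x y)) =
  \sum_i \sum_j xi_mx i j * ((th i x : R) * (th j y : R)) :> R.
Proof. by rewrite [LHS]netform_QQE [LHS]netformE. Qed.

Lemma q_pencilE x y : q_pencil (QQpr (sprod x y)) =
  \sum_i \sum_j pencil_mx i j * ((th i x : R) * (th j y : R)) :> R.
Proof. by rewrite [LHS]netform_QQE [LHS]netformE. Qed.

Lemma q_inj (u : QQ rho) : q_xi u = 0 -> q_pencil u = 0 -> u = 0.
Proof.
case: (quot_pr_surj u) => t ->; rewrite -/(QQpr t) [q_xi _]netform_QQE [q_pencil _]netform_QQE.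
apply: (netform_exact chart_wF srel (half := cst (2%:R^-1)) (kappa := cst (fkappa fr))
  (kappaV := cst (fkappa fr)^-1)).
- by rewrite -rmorphMn -mulr_natr mulVf ?rmorph1 //; exact: two_neq0.
- by rewrite -rmorphM mulVf ?rmorph1 // fkappa0.
- move=> i j; rewrite /xi_mx /netmx fxi; case: ifP => _; last by rewrite rmorph0.
  by case: ifP => // _; rewrite rmorphN rmorphMn.
exact: pencil_mx_sum.
Qed.

(** The function modulo constants whose moments against the linear forms [l] of [E] are
    the [l e]. *)
Definition chart_embed (e : aqE q) : FF rho :=
  theta_inv rho s (pencil_coef 1) (pencil_coef 2) (pencil_coef 3) (pencil_coef 4)
    (fun i => cst (fl fr i e)).

Lemma theta_embed i e : th i (chart_embed e) = cst (fl fr i e) :> R.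
Proof. exact: (theta_invK sbasis chart_wF srel). Qed.

Lemma chart_theta_inj x y : (forall i, th i x = th i y) -> x = y.
Proof. exact: (theta_inj chart_wF srel). Qed.

Lemma chart_embedP a e e' :
  chart_embed (a *: e + e') = cst a *: chart_embed e + chart_embed e'.
Proof.
apply: chart_theta_inj => i.
by rewrite [RHS]thetaP !theta_embed linearP rmorphD rmorphM.
Qed.

Lemma cst_netmxE (x : {scalar aqV q}) e e' : cst (x (aqphi q (sprod e e'))) =
  \sum_i \sum_j cst (netmx fr x i j) * (cst (fl fr i e) * cst (fl fr j e')).
Proof.
rewrite (netmxE fr) rmorph_sum; apply: eq_bigr => i _; rewrite rmorph_sum.
by apply: eq_bigr => j _; rewrite !rmorphM.
Qed.

Lemma q_xi_embed e e' : q_xi (QQpr (sprod (chart_embed e) (chart_embed e'))) =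
  cst (aqxi q (aqphi q (sprod e e'))) :> R.
Proof.
by rewrite q_xiE cst_netmxE; do 2!apply: eq_bigr => ? _; rewrite !theta_embed.
Qed.

Lemma q_pencil_embed e e' : q_pencil (QQpr (sprod (chart_embed e) (chart_embed e'))) =
  cst (y1 (aqphi q (sprod e e'))) - X * cst (y0 (aqphi q (sprod e e'))) :> R.
Proof.
rewrite q_pencilE !cst_netmxE mulr_sumr -sumrB; apply: eq_bigr => i _.
rewrite mulr_sumr -sumrB; apply: eq_bigr => j _.
by rewrite !theta_embed /pencil_mx; ring.
Qed.

End FrameOnChart.

Lemma regular_linearP (R : pzRingType) (M : lmodType R) (u : {linear M -> R^o}) a x y :
  u (a *: x + y) = a * (u x : R) + u y :> R.
Proof. exact: linearP. Qed.

Lemma rmorphM3 (R S : pzRingType) (r : {rmorphism R -> S}) a b c :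
  r (a * (b * c)) = r a * (r b * r c).
Proof. by rewrite !rmorphM. Qed.

(** * Gluing over the projective line *)

(** The coordinates of [Y] on the two charts are inverse to each other, the exchange of
    [l0] and [l2] giving the normal form on the second chart. *)
Section Gluing.
Context (k : closedFieldType) (q : algebraic_quadruple k) (x0 x1 : {scalar aqV q}).
Variable fr : frame x0 x1.
Hypothesis char_neq2 : 2%N \notin [pchar k].
Context (f : P1_cover k).
Variables (X0 : OX0 f) (X1 : OX1 f) (s0 : OY0 f) (s1 : OY1 f).

Local Notation fr' := (frame_swap fr).
Local Notation s01 := (rY0 f s0).
Local Notation pc0 := (pencil_coef fr (cst0 f) X0).
Local Notation pc1 := (pencil_coef fr' (cst1 f) X1).

Hypothesis b0 : is_basis (f0 f) (fun i : 'I_4 => s0 ^+ i).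
Hypothesis b1 : is_basis (f1 f) (fun i : 'I_4 => s1 ^+ i).
Hypothesis b01 : is_basis (f01 f) (fun i : 'I_4 => s01 ^+ i).
Hypothesis rel0 : f0 f (pc0 0) + f0 f (pc0 1) * s0 + f0 f (pc0 2) * s0 ^+ 2 +
  f0 f (pc0 3) * s0 ^+ 3 + f0 f (pc0 4) * s0 ^+ 4 = 0.
Hypothesis rel1 : f1 f (pc1 0) + f1 f (pc1 1) * s1 + f1 f (pc1 2) * s1 ^+ 2 +
  f1 f (pc1 3) * s1 ^+ 3 + f1 f (pc1 4) * s1 ^+ 4 = 0.
Hypothesis tX0 : tX f = rX0 f X0.
Hypothesis tX1 : tX f * rX1 f X1 = 1.
Hypothesis s0s1 : s01 * rY1 f s1 = 1.

Definition c01 : {rmorphism k -> OX01 f} :=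
  GRing.RMorphism.clone _ _ (rX0 f \o cst0 f) _.

Local Notation pc01 := (pencil_coef fr c01 (tX f)).

Lemma rel01 : f01 f (pc01 0) + f01 f (pc01 1) * s01 + f01 f (pc01 2) * s01 ^+ 2 +
  f01 f (pc01 3) * s01 ^+ 3 + f01 f (pc01 4) * s01 ^+ 4 = 0.
Proof.
have rM a b : rY0 f (f0 f a * b) = f01 f (rX0 f a) * rY0 f b by rewrite rmorphM fr0.
have := congr1 (rY0 f) rel0; rewrite rmorph0 !(rmorphD (rY0 f)) !rM !rmorphXn fr0.
by rewrite /pencil_coef !rmorphB !rmorphM -tX0.
Qed.

Local Notation w0 := (chart_w fr (cst0 f)).
Local Notation w1 := (chart_w fr' (cst1 f)).
Local Notation w01 := (chart_w fr c01).
Local Notation lam0 := (euler_fun b0 w0).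
Local Notation lam1 := (euler_fun b1 w1).
Local Notation lam01 := (euler_fun b01 w01).
Local Notation th0 := (theta b0 w0).
Local Notation th1 := (theta b1 w1).
Local Notation th01 := (theta b01 w01).

Lemma lam01_res0 a : lam01 (rY0 f a) = rX0 f (lam0 a).
Proof.
have H := @euler_transport _ _ _ _ _ _ _ _ (@fr0 _ f) _ _ b0 b01 w0 w01 1.
rewrite -H ?mul1r // => i i4.
by rewrite mul1r rmorphXn !eulerX //; case: ifP => _; rewrite ?rmorph0.
Qed.

(** The relation [F(s) / s = 0] computes [1 / s]: up to [x] and constants it is
    [s^3] plus a combination of [1, s, s^2]. *)
Lemma lam01_inv : tX f * lam01 (rY1 f s1) = rX1 f w1.
Proof.
have wF := chart_wF fr c01 (tX f).
have := congr1 (fun z => lam01 (z * rY1 f s1)) rel01.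
rewrite mul0r euler0 !mulrDl !eulerD -!(mulrA (f01 f _)) !eulerZ.
have sk i : s01 ^+ i.+1 * rY1 f s1 = s01 ^+ i by rewrite exprSr -mulrA s0s1 mulr1.
rewrite s0s1 !sk !eulerX // mulrC => e.
have e0 : lam01 (rY1 f s1) * pc01 0 = -1.
  have l1 : lam01 1 = 0 by rewrite -(expr0 s01) eulerX.
  apply/eqP; rewrite -addr_eq0; apply/eqP; rewrite -[RHS]e l1 /= !mulr0 !addr0.
  by rewrite [pc01 4 * _]mulrC wF.
move: e0; rewrite /pencil_coef (netpoly_ends fr x1).1 fx1 rmorph0 sub0r mulrN.
move=> /oppr_inj e0.
rewrite /chart_w -cst01 -/(c01 _) (netpoly_ends fr' x0).2 fe_swap.
rewrite [rev_ord _](_ : _ = ord0); last exact: val_inj.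
set c := (netpoly fr x0)`_0 in e0 *.
have cE : x0 (gmap (fe fr ord0)) = c by rewrite -(netpoly_ends fr x0).1.
have c0 : c != 0.
  have := gmap_neq0 fr' (e_neq0 fr ord0); rewrite -cE; apply=> //; last exact: fx1.
  exact: (xi_e_end fr).2.
rewrite cE -[LHS]mulr1 -(rmorph1 c01) -(divff c0) rmorphM mulrA.
by rewrite -[RHS]mul1r -e0; congr (_ * _); ring.
Qed.

(** In the residue formula, replacing [s] by [u = 1 / s] and [F(s)] by
    [- u^4 F(1 / u) / x] multiplies the derivative by [u^2 / x], hence the factor [x s^2]. *)
Lemma lam01_res1 a : lam01 (f01 f (tX f) * s01 ^+ 2 * rY1 f a) = rX1 f (lam1 a).
Proof.
apply: (@euler_transport _ _ _ _ _ _ _ _ (@fr1 _ f) _ _ b1 b01 w1 w01) => i i4.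
rewrite rmorphXn -mulrA eulerZ eulerX //.
have sk j : s01 ^+ j.+1 * rY1 f s1 = s01 ^+ j by rewrite exprSr -mulrA s0s1 mulr1.
case: i i4 => [|[|[|[|//]]]] _ /=.
- by rewrite mulr1 eulerX // rmorph0 mulr0.
- by rewrite expr1 sk eulerX // rmorph0 mulr0.
- by rewrite [rY1 f s1 ^+ 2]expr2 mulrA !sk eulerX // rmorph0 mulr0.
have -> : s01 ^+ 2 * rY1 f s1 ^+ 3 = (s01 * rY1 f s1) ^+ 2 * rY1 f s1 by ring.
by rewrite s0s1 expr1n mul1r lam01_inv.
Qed.

Lemma th01_res0 i x : th01 i (resF0 x) = rX0 f (th0 i x) :> OX01 f.
Proof.
case: (quot_pr_surj x) => a ->; rewrite -/(FFpr _ a) /resF0 FFresE !thetaE.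
by rewrite -lam01_res0 rmorphM rmorphXn.
Qed.

Lemma th01_res1 i y : tX f * th01 (rev_ord i) (resF1 y) = rX1 f (th1 i y) :> OX01 f.
Proof.
case: (quot_pr_surj y) => a ->; rewrite -/(FFpr _ a) /resF1 FFresE !thetaE.
rewrite -lam01_res1 -eulerZ rmorphM rmorphXn.
have sk j : s01 ^+ j.+1 * rY1 f s1 = s01 ^+ j by rewrite exprSr -mulrA s0s1 mulr1.
have -> : s01 ^+ rev_ord i = s01 ^+ 2 * rY1 f s1 ^+ i.
  case: i => [[|[|[|//]]] ?] /=; first by rewrite mulr1.
    by rewrite expr1 sk.
  by rewrite [rY1 f s1 ^+ 2]expr2 mulrA !sk.
by congr lam01; ring.
Qed.

Definition xi0 : {linear QQ (f0 f) -> (OX0 f)^o} := q_xi fr (cst0 f) b0.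
Definition xi1 : {linear QQ (f1 f) -> (OX1 f)^o} := q_xi fr' (cst1 f) b1.
Definition xi01 : {linear QQ (f01 f) -> (OX01 f)^o} := q_xi fr c01 b01.
Definition pencil0 : {linear QQ (f0 f) -> (OX0 f)^o} := q_pencil b0 rel0.
Definition pencil1 : {linear QQ (f1 f) -> (OX1 f)^o} := q_pencil b1 rel1.
Definition pencil01 : {linear QQ (f01 f) -> (OX01 f)^o} := q_pencil b01 rel01.

Lemma xi01_res0 t : xi01 (QQpr (resS0 t)) = rX0 f (xi0 (QQpr t)).
Proof.
move: t; apply: sym2_ind => [|x y].
  split=> [|a x y Px Py]; first by rewrite resS00 !QQpr0 !linear0 rmorph0.
  by rewrite resS0P !QQprP !regular_linearP Px Py rmorphD rmorphM.
rewrite resS0_sprod [LHS]q_xiE [xi0 _]q_xiE rmorph_sum; apply: eq_bigr => i _.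
rewrite rmorph_sum; apply: eq_bigr => j _.
by rewrite rmorphM3 !th01_res0.
Qed.

Lemma pencil01_res0 t : pencil01 (QQpr (resS0 t)) = rX0 f (pencil0 (QQpr t)).
Proof.
move: t; apply: sym2_ind => [|x y].
  split=> [|a x y Px Py]; first by rewrite resS00 !QQpr0 !linear0 rmorph0.
  by rewrite resS0P !QQprP !regular_linearP Px Py rmorphD rmorphM.
rewrite resS0_sprod [LHS]q_pencilE [pencil0 _]q_pencilE rmorph_sum.
apply: eq_bigr => i _; rewrite rmorph_sum; apply: eq_bigr => j _.
by rewrite rmorphM3 !th01_res0 /pencil_mx tX0 rmorphB [rX0 f (X0 * _)]rmorphM.
Qed.

Lemma c01E c : rX1 f (cst1 f c) = c01 c.
Proof. by rewrite -cst01. Qed.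

Lemma netmx_swap (x : {scalar aqV q}) i j :
  netmx fr' x i j = netmx fr x (rev_ord i) (rev_ord j).
Proof. by rewrite /netmx !fe_swap. Qed.

Lemma xi01_res1 t : tX f ^+ 2 * (xi01 (QQpr (resS1 t)) : OX01 f) = rX1 f (xi1 (QQpr t)).
Proof.
move: t; apply: sym2_ind => [|x y].
  split=> [|a x y Px Py]; first by rewrite resS10 !QQpr0 !linear0 rmorph0 mulr0.
  rewrite resS1P !QQprP !regular_linearP rmorphD rmorphM -Px -Py; ring.
rewrite resS1_sprod [xi01 _]q_xiE [xi1 _]q_xiE mulr_sumr rmorph_sum.
rewrite (reindex_inj rev_ord_inj); apply: eq_bigr => i _.
rewrite mulr_sumr rmorph_sum (reindex_inj rev_ord_inj); apply: eq_bigr => j _.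
rewrite rmorphM3 -!th01_res1 /xi_mx netmx_swap c01E; ring.
Qed.

Lemma pencil01_res1 t : tX f ^+ 2 * (pencil01 (QQpr (resS1 t)) : OX01 f) =
  - (tX f * rX1 f (pencil1 (QQpr t))).
Proof.
move: t; apply: sym2_ind => [|x y].
  split=> [|a x y Px Py]; first by rewrite resS10 !QQpr0 !linear0 rmorph0 !mulr0 oppr0.
  rewrite resS1P !QQprP !regular_linearP rmorphD rmorphM.
  rewrite mulrDr mulrDr opprD -Py mulrCA Px; ring.
rewrite resS1_sprod [pencil01 _]q_pencilE [pencil1 _]q_pencilE mulr_sumr rmorph_sum.
rewrite mulr_sumr -sumrN (reindex_inj rev_ord_inj); apply: eq_bigr => i _.
rewrite mulr_sumr rmorph_sum mulr_sumr -sumrN (reindex_inj rev_ord_inj).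
apply: eq_bigr => j _.
rewrite rmorphM3 -!th01_res1 /pencil_mx !netmx_swap rmorphB [rX1 f (X1 * _)]rmorphM !c01E.
set a := c01 _; set b := c01 _; set u := theta _ _ _ _; set v := theta _ _ _ _.
rewrite -[a in LHS]mul1r -tX1; ring.
Qed.

(** The global sections of [O] and of [O(1)] on the projective line [X]. *)
Hypothesis glue0 : forall a b, rX0 f a = rX1 f b ->
  exists c, a = cst0 f c /\ b = cst1 f c.
Hypothesis glue1 : forall a b, rX0 f a = tX f * rX1 f b ->
  exists c c', a = cst0 f c + X0 * cst0 f c' /\ b = cst1 f c' + X1 * cst1 f c.
Hypothesis free0 : forall c c', cst0 f c = X0 * cst0 f c' -> c = 0 /\ c' = 0.

Lemma cst0_inj c c' : cst0 f c = cst0 f c' -> c = c'.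
Proof.
move=> cc; apply/eqP; rewrite -subr_eq0; apply/eqP.
by have [] := @free0 (c - c') 0; rewrite ?rmorphB ?cc ?subrr ?rmorph0 ?mulr0.
Qed.

Local Notation emb0 := (chart_embed fr (f0 f) (cst0 f) X0 s0).
Local Notation emb1 := (chart_embed fr' (f1 f) (cst1 f) X1 s1).

Lemma alpha_subproof e : (emb0 e : FF0 f, emb1 e : FF1 f) \in @F1_section _ f.
Proof.
apply/asboolP; apply: (chart_theta_inj (sbasis := b01) rel01) => i.
rewrite [LHS]th01_res0 (theta_embed b0 rel0).
rewrite -[X in theta _ _ X](rev_ordK i) [RHS](linearZ_LR (th01 _)) [RHS]th01_res1.
by rewrite (theta_embed b1 rel1) cst01 fl_swap rev_ordK.
Qed.

(** The moments against the linear forms [l] agree on both charts with the constants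
    [l e]: this is the duality between [E] and the sections of [F(1)]. *)
Definition alpha_fun e : E_YX f := EYX (alpha_subproof e).

Lemma alpha_linear : linear alpha_fun.
Proof.
move=> a x y; apply: val_inj; congr (_, _); first exact: chart_embedP.
exact: chart_embedP.
Qed.

Definition alpha : {linear aqE q -> E_YX f} :=
  HB.pack alpha_fun (GRing.isLinear.Build k (aqE q) (E_YX f) *:%R alpha_fun alpha_linear).

Lemma alpha_inj : injective alpha.
Proof.
move=> e e' /(congr1 val) [/(congr1 (fun x => theta b0 w0 ^~ x)) ee' _].
rewrite (fe_expand fr e) (fe_expand fr e'); apply: eq_bigr => i _; congr (_ *: _).
apply: cst0_inj.
by have := congr1 (fun g => g i) ee'; rewrite !(theta_embed b0 rel0).
Qed.

Lemma alpha_surj x : exists e, alpha e = x.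
Proof.
case: x => [[a b] xS].
have /asboolP /= ab := xS.
have /choice[c cE] : forall i, exists c, th0 i a = cst0 f c /\ th1 (rev_ord i) b = cst1 f c.
  move=> i; apply: glue0; rewrite -th01_res0 -th01_res1 rev_ordK ab.
  exact: (linearZ_LR (th01 i)).
exists (\sum_i c i *: fe fr i); apply: val_inj.
congr (_, _).
  apply: (chart_theta_inj (sbasis := b0) rel0) => i.
  by rewrite [LHS](theta_embed b0 rel0) l_sum (cE i).1.
apply: (chart_theta_inj (sbasis := b1) rel1) => i.
by rewrite [LHS](theta_embed b1 rel1) fl_swap l_sum -(cE _).2 rev_ordK.
Qed.

Lemma psi_bilinear : sym_bilinear (fun e e' => phi_YX f (sprod (alpha e) (alpha e'))).
Proof.
split=> [x y|a x y z]; first by rewrite sprodC.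
by rewrite linearP sprodPl linearP.
Qed.

(** It has the same kernel as [phi], hence descends to [beta] on [V]. *)
Definition psi : {linear Sym2 (aqE q) -> V_YX f} := sym2_lift psi_bilinear.

Lemma psiE e e' : psi (sprod e e') = phi_YX f (sprod (alpha e) (alpha e')).
Proof. exact: (sym2_liftE psi_bilinear). Qed.

Lemma psi_coord t :
  [/\ xi0 (psi t).1 = cst0 f (aqxi q (aqphi q t)),
      pencil0 (psi t).1 = cst0 f (x1 (aqphi q t)) - X0 * cst0 f (x0 (aqphi q t)),
      xi1 (psi t).2 = cst1 f (aqxi q (aqphi q t))
    & pencil1 (psi t).2 = cst1 f (x0 (aqphi q t)) - X1 * cst1 f (x1 (aqphi q t))].
Proof.
move: t; apply: sym2_ind => [|e e'].
  split; first by rewrite !linear0 !rmorph0 !mulr0 !subr0.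
  move=> a t t' [t1 t2 t3 t4] [t1' t2' t3' t4'].
  rewrite (linearP psi).
  rewrite -[(a *: psi t + psi t').1]/(cst0 f a *: ((psi t).1 : QQ (f0 f)) + (psi t').1).
  rewrite -[(a *: psi t + psi t').2]/(cst1 f a *: ((psi t).2 : QQ (f1 f)) + (psi t').2).
  rewrite !regular_linearP t1 t2 t3 t4 t1' t2' t3' t4' !linearP !rmorphD !rmorphM.
  by split=> //; ring.
rewrite psiE; rewrite /phi_YX sym2_liftE.
split.
- exact: (q_xi_embed b0 rel0).
- exact: (q_pencil_embed b0 rel0).
- exact: (q_xi_embed b1 rel1).
exact: (q_pencil_embed b1 rel1).
Qed.

Lemma q0_eq (u u' : QQ (f0 f)) : xi0 u = xi0 u' -> pencil0 u = pencil0 u' -> u = u'.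
Proof.
move=> xiu pu; apply/eqP; rewrite -subr_eq0; apply/eqP.
apply: (q_inj char_neq2 (sbasis := b0) (srel := rel0)).
  by rewrite linearB [X in X - _]xiu; exact: subrr.
by rewrite linearB [X in X - _]pu; exact: subrr.
Qed.

Lemma q1_eq (u u' : QQ (f1 f)) : xi1 u = xi1 u' -> pencil1 u = pencil1 u' -> u = u'.
Proof.
move=> xiu pu; apply/eqP; rewrite -subr_eq0; apply/eqP.
apply: (q_inj char_neq2 (sbasis := b1) (srel := rel1)).
  by rewrite linearB [X in X - _]xiu; exact: subrr.
by rewrite linearB [X in X - _]pu; exact: subrr.
Qed.

(** [Q(2)] is glued from the two charts as [O + O(1)]: the conic of [xi] gives a
    section of [O], and the pencil through the fibre a section of [O(1)]. *)
Lemma VYX_coord (v : V_YX f) : exists a b c,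
  [/\ xi0 v.1 = cst0 f c, pencil0 v.1 = cst0 f b - X0 * cst0 f a,
      xi1 v.2 = cst1 f c & pencil1 v.2 = cst1 f a - X1 * cst1 f b].
Proof.
case: v => [[v0 v1] vS]; have /asboolP[t0 [t1 [/= v0E v1E tt]]] := vS.
have [|c [c0 c1]] := glue0 (a := xi0 v0) (b := xi1 v1).
  rewrite v0E v1E -xi01_res0 -xi01_res1 tt.
  exact: (linearZ_LR xi01).
have [|b [a [p0E p1E]]] := glue1 (a := pencil0 v0) (b := - (pencil1 v1 : OX1 f)).
  rewrite v0E v1E -pencil01_res0 rmorphN mulrN -pencil01_res1 tt.
  exact: (linearZ_LR pencil01).
exists (- a), b, c; split=> //.
  by apply: (etrans p0E); rewrite rmorphN mulrN opprK.
by apply: oppr_inj; apply: (etrans p1E); rewrite rmorphN; ring.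
Qed.

Lemma psi_surj v : exists t, psi t = v.
Proof.
have [a [b [c [v0 v1 v2 v3]]]] := VYX_coord v.
have [u [u0 u1 u2]] := fV_surj fr a b c.
have [t tu] := aqphi_surj u; exists t.
have [t0 t1 t2 t3] := psi_coord t.
apply: val_inj; rewrite [LHS]surjective_pairing [RHS]surjective_pairing; congr (_, _).
  by apply: q0_eq; rewrite ?t0 ?t1 ?v0 ?v1 tu ?u0 ?u1 ?u2.
by apply: q1_eq; rewrite ?t2 ?t3 ?v2 ?v3 tu ?u0 ?u1 ?u2.
Qed.

Lemma psi_phi t t' : psi t = psi t' <-> aqphi q t = aqphi q t'.
Proof.
have [t0 t1 t2 t3] := psi_coord t; have [t0' t1' t2' t3'] := psi_coord t'; split=> tt'.
  have e1 : cst0 f (x1 (aqphi q t) - x1 (aqphi q t')) =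
      X0 * cst0 f (x0 (aqphi q t) - x0 (aqphi q t')).
    have e : cst0 f (x1 (aqphi q t)) - X0 * cst0 f (x0 (aqphi q t)) =
        cst0 f (x1 (aqphi q t')) - X0 * cst0 f (x0 (aqphi q t')).
      by rewrite -t1 -t1' tt'.
    rewrite !rmorphB mulrBr; apply/eqP; rewrite -subr_eq0; apply/eqP.
    apply: etrans (subrr (cst0 f (x1 (aqphi q t)) - X0 * cst0 f (x0 (aqphi q t)))).
    by rewrite {2}e; ring.
  have [/eqP + /eqP] := free0 e1; rewrite !subr_eq0 => /eqP x1t /eqP x0t.
  apply: (fV_inj fr) => //; apply: cst0_inj.
  by rewrite -t0 -t0' tt'.
apply: val_inj; rewrite [LHS]surjective_pairing [RHS]surjective_pairing; congr (_, _).
  by apply: q0_eq; rewrite ?t0 ?t1 ?t0' ?t1' tt'.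
by apply: q1_eq; rewrite ?t2 ?t3 ?t2' ?t3' tt'.
Qed.

Definition phi_section (v : aqV q) : Sym2 (aqE q) := projT1 (cid (aqphi_surj v)).

Lemma phi_sectionK v : aqphi q (phi_section v) = v.
Proof. by rewrite /phi_section; case: cid. Qed.

Definition beta_fun v : V_YX f := psi (phi_section v).

Lemma beta_linear : linear beta_fun.
Proof.
move=> a v v'; rewrite /beta_fun -(linearP psi); apply/psi_phi.
by rewrite linearP !phi_sectionK.
Qed.

Definition beta : {linear aqV q -> V_YX f} :=
  HB.pack beta_fun (GRing.isLinear.Build k (aqV q) (V_YX f) *:%R beta_fun beta_linear).

Lemma beta_phi t : beta (aqphi q t) = psi t.
Proof. by apply/psi_phi; rewrite phi_sectionK. Qed.

Lemma beta_coord v :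
  [/\ xi0 (beta v).1 = cst0 f (aqxi q v),
      pencil0 (beta v).1 = cst0 f (x1 v) - X0 * cst0 f (x0 v),
      xi1 (beta v).2 = cst1 f (aqxi q v)
    & pencil1 (beta v).2 = cst1 f (x0 v) - X1 * cst1 f (x1 v)].
Proof. by have := psi_coord (phi_section v); rewrite phi_sectionK. Qed.

Lemma beta_inj : injective beta.
Proof. by move=> v v' /psi_phi; rewrite !phi_sectionK. Qed.

Lemma beta_surj v : exists u, beta u = v.
Proof. by have [t <-] := psi_surj v; exists (aqphi q t); exact: beta_phi. Qed.

Lemma xi_YX_exists : exists xi : {scalar V_YX f}, is_xi_YX xi.
Proof.
have /choice[xi xiE] : forall v : V_YX f, exists c, xi0 v.1 = cst0 f c /\ xi1 v.2 = cst1 f c.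
  by move=> v; have [a [b [c []]]] := VYX_coord v; exists c.
have xi_lin : linear_for *%R xi.
  move=> a v w; apply: cst0_inj; rewrite -(xiE _).1.
  rewrite -[(a *: v + w).1]/(cst0 f a *: (v.1 : QQ (f0 f)) + w.1).
  by rewrite regular_linearP (xiE v).1 (xiE w).1 rmorphD rmorphM.
exists (HB.pack xi (GRing.isLinear.Build k (V_YX f) k *%R xi xi_lin) : {scalar V_YX f}).
exists xi0, xi1, xi01; split.
- exact: xi01_res0.
- by move=> t; rewrite -xi01_res1; exact: (linearZ_LR xi01).
- left; have [v [_ _ vxi]] := fV_surj fr 0 0 1.
  exists (beta v).1; have [-> _ _ _] := beta_coord v; rewrite vxi.
  apply/eqP => c10; have /eqP := cst0_inj (etrans c10 (esym (rmorph0 (cst0 f)))).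
  by rewrite oner_eq0.
exact: xiE.
Qed.

(** A morphism [Q(2) -> O] kills the summand [O(1)]: on the first chart two independent
    sections of [O(1)] differ by the nonconstant factor [- x], while their images are
    constants. It is hence a multiple of the projection to the summand [O]. *)
Lemma xi_YX_unique (xi : {scalar V_YX f}) : is_xi_YX xi ->
  exists2 c, c != 0 & forall v, xi (beta v) = c * aqxi q v.
Proof.
move=> [chi0 [chi1 [chi01 [_ _ chi_neq0 chiE]]]].
have [va [va0 va1 va2]] := fV_surj fr 1 0 0.
have [vb [vb0 vb1 vb2]] := fV_surj fr 0 1 0.
have [vc [vc0 vc1 vc2]] := fV_surj fr 0 0 1.
have [va_xi0 va_p0 va_xi1 va_p1] := beta_coord va.
have [vb_xi0 vb_p0 vb_xi1 vb_p1] := beta_coord vb.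
have [vc_xi0 vc_p0 vc_xi1 vc_p1] := beta_coord vc.
rewrite !(va0, va1, va2, vb0, vb1, vb2, vc0, vc1, vc2) !rmorph0 ?rmorph1 in
  va_xi0 va_p0 va_xi1 va_p1 vb_xi0 vb_p0 vb_xi1 vb_p1 vc_xi0 vc_p0 vc_xi1 vc_p1.
have ab : (beta va).1 = (- X0) *: ((beta vb).1 : QQ (f0 f)).
  apply: q0_eq.
    by rewrite [RHS](linearZ_LR xi0) va_xi0 vb_xi0 scaler0.
  rewrite [RHS](linearZ_LR pencil0) va_p0 vb_p0 -[RHS]/(- X0 * _); ring.
have [xib xia] : xi (beta va) = 0 /\ xi (beta vb) = 0.
  have /free0[/eqP] : cst0 f (- xi (beta va)) = X0 * cst0 f (xi (beta vb)).
    have [+ _] := chiE (beta va); have [+ _] := chiE (beta vb).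
    move=> chib chia; rewrite rmorphN -chia -chib [X in chi0 X]ab (linearZ_LR chi0).
    by rewrite -[_ *: _]/(- X0 * _); ring.
  by rewrite oppr_eq0 => /eqP -> ->.
have xiE v : xi (beta v) = xi (beta vc) * aqxi q v.
  have -> : v = x0 v *: va + x1 v *: vb + aqxi q v *: vc.
    by apply: (fV_inj fr); rewrite !linearD !linearZ /=
      !(va0, va1, va2, vb0, vb1, vb2, vc0, vc1, vc2) !(mulr0, mulr1, addr0, add0r).
  rewrite !linearD !linearZ /= xib xia va2 vb2 vc2.
  by rewrite !(mulr0, mulr1, addr0, add0r) mulrC.
exists (xi (beta vc)) => //; apply/eqP => xic.
have xi0v v : xi v = 0 by have [u <-] := beta_surj v; rewrite xiE xic mul0r.
case: chi_neq0 => [[u /eqP]|[u /eqP]]; apply.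
  (* The sections coming from [V] generate [Q] on each chart. *)
  have -> : u = (xi0 u : OX0 f) *: ((beta vc).1 : QQ (f0 f)) +
      (pencil0 u : OX0 f) *: ((beta vb).1 : QQ (f0 f)).
    by apply: q0_eq; rewrite regular_linearP [in RHS](linearZ_LR _) ?vc_xi0 ?vc_p0 ?vb_xi0 ?vb_p0
      -[_ *: _]/(_ * _) ; ring.
  rewrite regular_linearP (linearZ_LR chi0) !(chiE _).1 !xi0v rmorph0 mulr0 scaler0.
  exact: addr0.
have -> : u = (xi1 u : OX1 f) *: ((beta vc).2 : QQ (f1 f)) +
    (pencil1 u : OX1 f) *: ((beta va).2 : QQ (f1 f)).
  by apply: q1_eq; rewrite regular_linearP [in RHS](linearZ_LR _) ?vc_xi1 ?vc_p1 ?va_xi1 ?va_p1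
    -[_ *: _]/(_ * _) ; ring.
rewrite regular_linearP (linearZ_LR chi1) !(chiE _).2 !xi0v rmorph0 mulr0 scaler0.
exact: addr0.
Qed.

Lemma inj_surj_bij (S T : Type) (g : S -> T) :
  injective g -> (forall y, exists x, g x = y) -> bijective g.
Proof.
move=> gi /choice[h hK]; exists h => // x.
by apply: gi; rewrite hK.
Qed.

Lemma gluing_iso :
  (exists xi : {scalar V_YX f}, is_xi_YX xi) /\
  (forall xi : {scalar V_YX f}, is_xi_YX xi ->
     quadruple_iso (quadruple_of q) (Quadruple (phi_YX f) xi)).
Proof.
split=> [|xi /xi_YX_unique[c c0 xiE]]; first exact: xi_YX_exists.
exists alpha, beta, c; split=> //.
- by apply: inj_surj_bij; [exact: alpha_inj | exact: alpha_surj].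
- by apply: inj_surj_bij; [exact: beta_inj | exact: beta_surj].
by move=> x y; exact: etrans (beta_phi _) (psiE x y).
Qed.
End Gluing.

(** * The cover attached to a quadruple *)

Section PrincipalChart.
Context (k : closedFieldType) (q : algebraic_quadruple k) (x0 x1 : {scalar aqV q}).
Variable fr : frame x0 x1.
Hypothesis char_neq2 : 2%N \notin [pchar k].

Local Notation p0 := (netpoly fr x0).
Local Notation p1 := (netpoly fr x1).
Local Notation ratio v := (x1 v / x0 v).

Lemma principal_UE (v : aqV q) : Xcone v ->
  D0 x0 v <-> x0 v != 0 /\ (1 : {poly k}).[ratio v] != 0.
Proof. by move=> _; rewrite hornerC oner_neq0; split=> [|[]]. Qed.

Let principal_WE s : p0.[s] != 0 -> p0.[s] = p0.[s] ^+ 1 * (1 : {poly k}).[p1.[s] / p0.[s]].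
Proof. by rewrite hornerC mulr1. Qed.

Definition principal_X : reg (Xopen (D0 x0)) := Xcoord principal_UE.
Definition principal_Y : reg (Yopen (D0 x0)) := Ycoord fr char_neq2 principal_UE.

Lemma principal_basis : is_basis (fsharp (D0 x0)) (fun i : 'I_4 => principal_Y ^+ i).
Proof.
apply: (@Ycoord_basis _ _ _ _ fr char_neq2 _ 1 p0 1 _ _ _ _ _ 1) => //.
- exact: oner_neq0.
- exact: netpoly0_neq0.
by move=> v; rewrite hornerC invr1.
Qed.

Local Notation pc := (pencil_coef fr (@reg_const k (aqV q) (Xopen (D0 x0))) principal_X).
Local Notation rho := (fsharp (D0 x0)).

Lemma principal_rel :
  rho (pc 0) + rho (pc 1) * principal_Y + rho (pc 2) * principal_Y ^+ 2 +
  rho (pc 3) * principal_Y ^+ 3 + rho (pc 4) * principal_Y ^+ 4 = 0.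
Proof. by apply: (@netcoef_rel _ _ _ _ fr char_neq2 _ 1 p0 1). Qed.

Lemma principal_fraction (g : reg (Xopen (D0 x0))) :
  exists N : {poly k}, forall v : Xopen (D0 x0), g v = N.[ratio (val v)].
Proof.
have [N [d gE]] := Xreg_fraction fr principal_UE (oner_neq0 _) g.
by exists N => v; rewrite gE hornerC expr1n divr1.
Qed.
End PrincipalChart.

Section MiddleChart.
Context (k : closedFieldType) (q : algebraic_quadruple k) (x0 x1 : {scalar aqV q}).
Variable fr : frame x0 x1.
Hypothesis char_neq2 : 2%N \notin [pchar k].

Local Notation p0 := (netpoly fr x0).
Local Notation p1 := (netpoly fr x1).
Local Notation ratio v := (x1 v / x0 v).
Local Notation U01 := (D0 x0 `&` D1 x1)%classic.

Lemma middle_UE (v : aqV q) : Xcone v ->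
  U01 v <-> x0 v != 0 /\ ('X : {poly k}).[ratio v] != 0.
Proof.
move=> _; rewrite hornerX mulf_eq0 invr_eq0 negb_or /D0 /D1 /=.
by split=> [[x0v x1v]|[x0v /andP[x1v _]]]; split=> //; rewrite x1v.
Qed.

Lemma middle_inv_regular :
  (fun v : Xopen U01 => x0 (val v) / x1 (val v)) \in @regular _ _ (Xopen U01).
Proof.
apply/asboolP => p; exists 1, x0, x1; split=> //; do ?exact: form_scalar.
by case: (set_mem (valP p)) => _ [].
Qed.

Definition middle_Y : reg (Yopen U01) := Ycoord fr char_neq2 middle_UE.

Lemma middle_basis : is_basis (fsharp U01) (fun i : 'I_4 => middle_Y ^+ i).
Proof.
have p10 : p1 != 0 by rewrite -size_poly_eq0 netpoly1_size.
apply: (@Ycoord_basis _ _ _ _ fr char_neq2 _ 'X (p0 * p1) 2 _ _ _ _ _ (Reg middle_inv_regular)).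
- by rewrite polyX_eq0.
- by rewrite mulf_neq0 // netpoly0_neq0.
- by move=> s; rewrite hornerM mulf_eq0 negb_or => /andP[].
- by move=> s p0s; rewrite hornerM hornerX; field.
by move=> v; rewrite hornerX invf_div.
Qed.
End MiddleChart.

Section AssocCover.
Context (k : closedFieldType) (q : algebraic_quadruple k) (x0 x1 : {scalar aqV q}).
Variable fr : frame x0 x1.
Hypothesis char_neq2 : 2%N \notin [pchar k].

Local Notation f := (assoc_cover x0 x1).
Local Notation fr' := (frame_swap fr).
Local Notation X0 := (principal_X x0 x1 : OX0 f).
Local Notation X1 := (principal_X x1 x0 : OX1 f).
Local Notation s0 := (principal_Y fr char_neq2 : OY0 f).
Local Notation s1 := (principal_Y fr' char_neq2 : OY1 f).

Lemma assoc_tX0 : tX f = rX0 f X0.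
Proof. exact: reg_eq. Qed.

Lemma assoc_tX1 : tX f * rX1 f X1 = 1.
Proof.
apply: reg_eq => v; rewrite -[LHS]/(x1 (val v) / x0 (val v) * (x0 (val v) / x1 (val v))).
by case: (set_mem (valP v)) => _ [x0v x1v]; rewrite reg1; field; rewrite x0v x1v.
Qed.

Lemma assoc_s0s1 : rY0 f s0 * rY1 f s1 = 1.
Proof.
apply: reg_eq => v; rewrite -[LHS]/(slope fr (val v) * slope fr' (val v)) reg1.
have [Yv [x0v x1v]] := set_mem (valP v).
have l0 := Ycone_l0 fr char_neq2 Yv x0v; have l2 := Ycone_l0 fr' char_neq2 Yv x1v.
rewrite fl_swap in l2; rewrite /slope !fl_swap.
have l1 := Ycone_l fr char_neq2 Yv.
rewrite (_ : rev_ord ord0 = ord_max) in l2 *; last exact: val_inj.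
rewrite (_ : rev_ord (lift ord0 ord0) = lift ord0 ord0); last exact: val_inj.
by rewrite mulf_div -expr2 -l1 divff // mulf_neq0.
Qed.

Lemma assoc_basis01 : is_basis (f01 f) (fun i : 'I_4 => rY0 f s0 ^+ i).
Proof.
have -> : rY0 f s0 = middle_Y fr char_neq2 by exact: reg_eq.
exact: middle_basis.
Qed.

Lemma Xpoint (r : k) : exists v : aqV q, [/\ x0 v = 1, x1 v = r & Xcone v].
Proof. exact: fV_surj fr 1 r 0. Qed.

Lemma restriction_eq (t : reg (Xopen (D0 x0 `&` D1 x1)%classic)) (N M : {poly k})
    (a : OX0 f) (b : OX1 f) :
  (forall v : Xopen (D0 x0), a v = N.[x1 (val v) / x0 (val v)]) ->
  (forall v : Xopen (D1 x1), b v = M.[x0 (val v) / x1 (val v)]) ->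
  rX0 f a = t * rX1 f b ->
  forall (v : Xopen (D0 x0 `&` D1 x1)%classic),
    N.[x1 (val v) / x0 (val v)] = t v * M.[x0 (val v) / x1 (val v)].
Proof.
move=> aE bE ab v; have := congr1 (fun g : OX01 f => g v) ab.
rewrite regM -[rX0 f a v]/(a _) -[rX1 f b v]/(b _) aE bE => <-.
by [].
Qed.

Lemma middle_point r : r != 0 ->
  exists v : Xopen (D0 x0 `&` D1 x1)%classic, x0 (val v) = 1 /\ x1 (val v) = r.
Proof.
move=> r0; have [v [v0 v1 vX]] := Xpoint r.
have Uv : Xopen (D0 x0 `&` D1 x1)%classic v.
  by split=> //; split; rewrite /D0 /D1 /= ?v0 ?v1 ?oner_neq0.
by exists (exist (fun v => v \in Xopen (D0 x0 `&` D1 x1)%classic) v (mem_set Uv)).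
Qed.

Lemma poly_size1 (p : {poly k}) x : (size p <= 1)%N -> p.[x] = p`_0.
Proof. by move=> p1; rewrite (horner_coef_wide _ p1) big_ord1 expr0 mulr1. Qed.

Lemma poly_size2 (p : {poly k}) x : (size p <= 2)%N -> p.[x] = p`_0 + x * p`_1.
Proof.
move=> p2; rewrite (horner_coef_wide _ p2) !big_ord_recl big_ord0 /= addr0.
by rewrite expr0 mulr1 mulrC.
Qed.

Lemma assoc_glue0 (a : OX0 f) (b : OX1 f) : rX0 f a = rX1 f b ->
  exists c, a = cst0 f c /\ b = cst1 f c.
Proof.
move=> ab; have [N aE] := principal_fraction fr a; have [M bE] := principal_fraction fr' b.
have NM r : r != 0 -> N.[r] = M.[r^-1].
  move=> /middle_point[v [v0 v1]].
  have := restriction_eq (t := 1) aE bE (etrans ab (esym (mul1r _))) v.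
  by rewrite v0 v1 divr1 reg1 !mul1r.
have sN : (size N <= 1)%N by apply: (@laurent_size _ 0 _ M) => r /NM ->; rewrite mul1r.
have sM : (size M <= 1)%N.
  by apply: (@laurent_size _ 0 _ N) => r r0; rewrite mul1r NM ?invr_neq0 // invrK.
exists N`_0; split; apply: reg_eq => v; rewrite ?aE ?bE poly_size1 //.
by have := NM 1 (oner_neq0 k); rewrite !poly_size1.
Qed.

Lemma assoc_glue1 (a : OX0 f) (b : OX1 f) : rX0 f a = tX f * rX1 f b ->
  exists c c', a = cst0 f c + X0 * cst0 f c' /\ b = cst1 f c' + X1 * cst1 f c.
Proof.
move=> ab; have [N aE] := principal_fraction fr a; have [M bE] := principal_fraction fr' b.
have NM r : r != 0 -> N.[r] = r * M.[r^-1].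
  move=> /middle_point[v [v0 v1]].
  have := restriction_eq aE bE ab v.
  by rewrite -[tX f v]/(x1 (val v) / x0 (val v)) v0 v1 divr1 mul1r.
have sN : (size N <= 2)%N by apply: (@laurent_size _ 1 _ M) => r /NM ->.
have sM : (size M <= 2)%N.
  apply: (@laurent_size _ 1 _ N) => r r0; rewrite NM ?invr_neq0 // invrK.
  by rewrite expr1 mulVKf.
(* Both sides are affine functions of [r], so their coefficients agree. *)
have NM0 : (N`_0 - M`_1)%:P + (N`_1 - M`_0) *: 'X = 0.
  apply: (@poly_eq0_on_open _ 'X) => [|r]; first by rewrite polyX_eq0.
  rewrite hornerX => r0; have := NM r r0.
  rewrite (poly_size2 r sN) (poly_size2 _ sM) => e; rewrite hornerD hornerC hornerZ hornerX.
  apply: etrans (subrr (N`_0 + r * N`_1)); rewrite {2}e.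
  by field.
have e0 := congr1 (fun p : {poly k} => p`_0) NM0.
have e1 := congr1 (fun p : {poly k} => p`_1) NM0.
rewrite /= coefD coefC coefZ coefX coef0 /= mulr0 addr0 in e0.
rewrite /= coefD coefC coefZ coefX coef0 /= mulr1 add0r in e1.
exists N`_0, N`_1; split; apply: reg_eq => v.
  by rewrite aE poly_size2.
by rewrite bE poly_size2 // (subr0_eq e0) (subr0_eq e1).
Qed.

Lemma assoc_free0 c c' : cst0 f c = X0 * cst0 f c' -> c = 0 /\ c' = 0.
Proof.
move=> cc.
have ev r : c = r * c'.
  have [v [v0 v1 vX]] := Xpoint r.
  have Uv : Xopen (D0 x0) v by split=> //; rewrite /D0 /= v0 oner_neq0.
  have := congr1 (fun g : OX0 f =>
    g (exist (fun v => v \in Xopen (D0 x0)) v (mem_set Uv))) cc.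
  by rewrite regM -[X0 _]/(x1 v / x0 v) v0 v1 divr1.
have c0 : c = 0 by rewrite (ev 0) mul0r.
by split=> //; rewrite -[c']mul1r -ev.
Qed.
End AssocCover.

Theorem theorem77 (k : closedFieldType)
  (char_neq2 : 2%N \notin [pchar k]) (char_neq3 : 3%N \notin [pchar k])
  (q : algebraic_quadruple k)
  (xi_smooth : ~ discriminant_locus (aqxi q))
  (x0 x1 : {scalar aqV q}) (x01_coord : coordinates_on_X x0 x1) :
  let f := assoc_cover x0 x1 in
  (exists xi_YX : {scalar V_YX f}, is_xi_YX xi_YX) /\
  (forall xi_YX : {scalar V_YX f}, is_xi_YX xi_YX ->
     quadruple_iso (quadruple_of q) (Quadruple (phi_YX f) xi_YX)).
Proof.
have [fr] := frame_exists char_neq2 xi_smooth x01_coord.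
apply: (gluing_iso (fr := fr) char_neq2 (f := assoc_cover x0 x1)
  (principal_basis fr char_neq2) (principal_basis (frame_swap fr) char_neq2)
  (assoc_basis01 fr char_neq2)
  (principal_rel fr char_neq2) (principal_rel (frame_swap fr) char_neq2)
  (assoc_tX0 x0 x1) (assoc_tX1 x0 x1) (assoc_s0s1 fr char_neq2)
  (assoc_glue0 fr) (assoc_glue1 fr) (assoc_free0 fr)).
Qed.
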